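(* Let $a,b>0$, and for $i\in\{0,1\}$, $j\in\{0,1,2,3\}$ let $\mathcal R_{ij}$ be the set of open rectangles that can move around the corner in the corridor $\mathcal C_{ij}=\mathcal A_i\cup\mathcal B_j$. Then $$\mathcal R_{00}=\mathcal R_{01}=\mathcal R_{02},\quad \mathcal R_{10}=\mathcal R_{12},\quad \mathcal R_{11}=\mathcal R_{13},\quad \mathcal R_{00}=\mathcal R_{10}\cup\mathcal R_{03},\quad \mathcal R_{13}=\mathcal R_{10}\cap\mathcal R_{03}.$$ Moreover, a rectangle with side lengths $c$ and $d$, $c\ge d>0$, belongs to the set: (i) $\mathcal R_{0i}$, $i=0,1,2$, if and only if $d\le a\wedge b$ and $cd\le ab$; (ii) $\mathcal R_{03}$ if and only if ($ii_1$) $h\le d\le a\wedge b$ and $cd\le ab$, or ($ii_2$) $d\le h\wedge m(a,b,c)$; (iii) $\mathcal R_{1i}$, $i=0,2$, if and only if ($iii_1$) $d\le h$ and $cd\le ab$, or ($iii_2$) $h\le d\le a\wedge b$ and $c\le a\vee b$, or ($iii_3$) $h\le d\le m(a,b,c)$; (iv) $\mathcal R_{1i}$, $i=1,3$, if and only if ($iv_1$) $c\le a\vee b$ and $d\le a\wedge b$, or ($iv_2$) $d\le m(a,b,c)$.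
   Context: Fix $a,b>0$. In the plane $\mathbb R^2$ with coordinates $(x,y)$ set $\mathcal D=\{x=a,\ 0<y<b\}$, $\mathcal A_0=\mathcal D\cup\{0<x<a\}$, $\mathcal B_0=\mathcal D\cup\{x>a\}$, $\mathcal A_1=\mathcal A_0\cap\{y>0\}$, $\mathcal B_1=\mathcal B_0\cap\{y>0\}$, $\mathcal B_2=\mathcal B_0\cap\{y<b\}$, $\mathcal B_3=\mathcal B_0\cap\{0<y<b\}$, and $\mathcal C_{ij}=\mathcal A_i\cup\mathcal B_j$ for $(i,j)\in\{0,1\}\times\{0,1,2,3\}$. An open rectangle $R$ (with sides in arbitrary directions) ''can move around the corner in $\mathcal C_{ij}$'' if there is a continuous path $\Phi_t$, $t\in[0,1]$, in the Euclidean group $E(2)$ of rigid motions of the plane such that $\Phi_0(R)\subset\mathcal A_i$, $\Phi_1(R)\subset\mathcal B_j$ and $\Phi_t(R)\subset\mathcal C_{ij}$ for all $t\in[0,1]$. $\mathcal R_{ij}$ is the set of all such $R$ (so membership depends only on the side lengths). Notation: $a\vee b=\max\{a,b\}$, $a\wedge b=\min\{a,b\}$ (and similarly for other numbers), $h=ab/\sqrt{a^2+b^2}$, and for $a,b,c>0$, $m(a,b,c)=\min_{t\in[0,\pi/2]}(a\sin t+b\cos t-c\sin t\cos t)$. *)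

(* Defs.v *)
From HB Require Import structures.
From mathcomp Require Import all_boot all_order all_algebra.
From mathcomp Require Import all_classical all_reals all_analysis.
Set Implicit Arguments.
Unset Strict Implicit.
Unset Printing Implicit Defensive.
Import Order.TTheory GRing.Theory Num.Theory.
Import numFieldNormedType.Exports.
Local Open Scope classical_set_scope.
Local Open Scope ring_scope.

Section Definitions.
Context {R : realType}.
Implicit Types (a b c d t : R) (i : 'I_2) (j : 'I_4).

Definition plane : Type := 'cV[R]_2.
Definition xcoord (p : plane) : R := p 0 0.
Definition ycoord (p : plane) : R := p 1 0.

(* A pair (U, v) stands for the map p |-> U p + v. E(2) is the subset of the
   pairs with U orthogonal; its topology is induced by the product topology. *)
Definition affine : Type := ('M[R]_2 * 'cV[R]_2)%type.
Definition euclidean : set affine := [set g | g.1^T *m g.1 = 1%:M].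
Definition motion (g : affine) (p : plane) : plane := g.1 *m p + g.2.

Definition open_rectangle c d (S : set plane) : Prop :=
  [/\ 0 < c, 0 < d &
      exists2 g, euclidean g &
        S = motion g @` [set p | 0 < xcoord p < c /\ 0 < ycoord p < d]].

Definition door a b : set plane := [set p | xcoord p = a /\ 0 < ycoord p < b].

Definition start_part a b i : set plane :=
  let A0 := door a b `|` [set p | 0 < xcoord p < a] in
  match val i with
  | 0%N => A0
  | _ => A0 `&` [set p | 0 < ycoord p]
  end.

Definition end_part a b j : set plane :=
  let B0 := door a b `|` [set p | a < xcoord p] in
  match val j with
  | 0%N => B0
  | 1%N => B0 `&` [set p | 0 < ycoord p]
  | 2%N => B0 `&` [set p | ycoord p < b]
  | _ => B0 `&` [set p | 0 < ycoord p < b]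
  end.

Definition corridor a b i j : set plane := start_part a b i `|` end_part a b j.

Definition can_move_around a b i j (S : set plane) : Prop :=
  exists Phi : R -> 'M[R]_2 * 'cV[R]_2,
    [/\ {within `[0, 1], continuous Phi},
        forall t, 0 <= t <= 1 -> euclidean (Phi t),
        motion (Phi 0) @` S `<=` start_part a b i,
        motion (Phi 1) @` S `<=` end_part a b j &
        forall t, 0 <= t <= 1 -> motion (Phi t) @` S `<=` corridor a b i j].

Definition movable a b i j : set (set plane) :=
  [set S | (exists c d, open_rectangle c d S) /\ can_move_around a b i j S].

Definition height a b : R := a * b / Num.sqrt (a ^+ 2 + b ^+ 2).

Definition mfun a b c t : R := a * sin t + b * cos t - c * sin t * cos t.

Definition m a b c : R := inf [set mfun a b c t | t in `[0, pi / 2]].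

Lemma m_is_min a b c :
  (exists2 t, 0 <= t <= pi / 2 & mfun a b c t = m a b c) /\
  (forall t, 0 <= t <= pi / 2 -> m a b c <= mfun a b c t).
Proof.
have pi2 : 0 <= pi / 2 :> R by rewrite divr_ge0 ?pi_ge0.
have cf : {within `[0, pi / 2], continuous (mfun a b c)}.
  apply: continuous_subspaceT => t; rewrite /mfun.
  apply: cvgB; first by apply: cvgD; apply: cvgM;
    [exact: cvg_cst|exact: continuous_sin|exact: cvg_cst|exact: continuous_cos].
  apply: cvgM; last exact: continuous_cos.
  by apply: cvgM; [exact: cvg_cst|exact: continuous_sin].
have [t0 t0I t0P] := EVT_min pi2 cf.
have lbm : lbound [set mfun a b c t | t in `[0, pi / 2]] (mfun a b c t0).
  by move=> _ [t tI <-]; apply: t0P.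
have mE : mfun a b c t0 = m a b c.
  apply/eqP; rewrite eq_le; apply/andP; split.
    by apply: lb_le_inf => //; exists (mfun a b c t0), t0.
  by apply: ge_inf; [exists (mfun a b c t0)|exists t0].
split; first by exists t0 => //; move: t0I; rewrite in_itv.
by move=> t tI; rewrite -mE; apply: t0P; rewrite in_itv.
Qed.

End Definitions.

(* Main.v *)
Require Import Defs.
From HB Require Import structures.
From mathcomp Require Import all_boot all_order all_algebra.
From mathcomp Require Import all_classical all_reals all_analysis.
From mathcomp Require Import ring lra.
Set Implicit Arguments.
Unset Strict Implicit.
Unset Printing Implicit Defensive.
Import Order.TTheory GRing.Theory Num.Theory.
Import numFieldNormedType.Exports.
Local Open Scope classical_set_scope.
Local Open Scope ring_scope.

(* Necessity.  The intermediate value theorem provides a time at which the center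
   of the rectangle is above the door, or at which its long side has a prescribed
   slope while its center (or its upper end) is still on the left of the door.
   In the first case the line x = a cuts a chord of known length, which has to
   fit into the door.  In the second case, if the rectangle slopes down to the
   right at the angle t, it is a thick ladder between the two axes that has to
   pass below the corner (a, b), so d <= a sin t + b cos t - c sin t cos t; the
   other slope is excluded by chords.  The identity
   (d - a sin t) (d - b cos t) =
     d (d - a sin t - b cos t + c sin t cos t) + (a b - c d) sin t cos t
   shows that, when c d <= a b, this inequality can only fail if d exceeds both
   a sin t and b cos t, hence d > h, or is below both of them, hence d < h.

   Sufficiency.  Three motions are combined: the ladder sliding along both axes,
   the translation along the long side just below the corner (a, b), and the
   tipping around the corner with one side on (a, b) and one on (a, 0).  They
   fit together at the angle with cos t = d / b. *)

(** * Rectangles inside a region of the plane *)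

(* The rectangle with center (x0, y0), sides c and d, and long axis along the
   unit vector (e1, e2), inside the region P. *)
Definition fits {R : realFieldType} (P : R -> R -> Prop) (c d x0 y0 e1 e2 : R) :=
  forall u v, -c < u * 2 < c -> -d < v * 2 < d ->
    P (x0 + u * e1 - v * e2) (y0 + u * e2 + v * e1).

(** All the corridors described by implications: [i] puts a floor on the left of the door, [lo] a
    floor on its right, [hi] a ceiling on its right. On the line [x = a] only the door is open,
    whatever the Booleans. *)
Definition region {R : realFieldType} (a b : R) (i lo hi : bool) (x y : R) :=
  [/\ 0 < x, x = a -> 0 < y < b, i -> x < a -> 0 < y,
      lo -> a < x -> 0 < y & hi -> a < x -> y < b].

(** A quarter turn exchanges the roles of the two sides, so that what is proved for chords across
    the long sides also serves across the short ones. *)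
Lemma fits_turn (R : realFieldType) (P : R -> R -> Prop) c d x0 y0 e1 e2 :
  fits P c d x0 y0 e1 e2 -> fits P d c x0 y0 (- e2) e1.
Proof.
move=> F u v hu hv.
have := F (- v) u; rewrite (_ : x0 + _ - _ = x0 + u * - e2 - v * e1); last ring.
rewrite (_ : y0 + _ + _ = y0 + u * e1 + v * - e2); last ring.
by apply; lra.
Qed.

Lemma fits_opp (R : realFieldType) (P : R -> R -> Prop) c d x0 y0 e1 e2 :
  fits P c d x0 y0 e1 e2 -> fits P c d x0 y0 (- e1) (- e2).
Proof. by move=> /fits_turn/fits_turn. Qed.

Lemma fits_mirror (R : realFieldType) (P P' : R -> R -> Prop) b c d x0 y0 e1 e2 :
  (forall x y, P x y -> P' x (b - y)) ->
  fits P c d x0 y0 e1 e2 -> fits P' c d x0 (b - y0) e1 (- e2).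
Proof.
move=> PP' F u v hu hv.
have /PP' : P (x0 + u * e1 - (- v) * e2) (y0 + u * e2 + (- v) * e1).
  by apply: F; lra.
congr P'; ring.
Qed.

(** By convexity, a segment from the closed rectangle to a point of the open one lies in the open
    one, except perhaps for its first point. This is how constraints pass to the boundary. *)
Lemma fits_segment (R : realFieldType) (P : R -> R -> Prop)
    c d x0 y0 e1 e2 u v u1 v1 r :
  fits P c d x0 y0 e1 e2 ->
  -c < u * 2 < c -> -d < v * 2 < d -> -c <= u1 * 2 <= c -> -d <= v1 * 2 <= d ->
  0 < r <= 1 ->
  let x' := x0 + u * e1 - v * e2 in let y' := y0 + u * e2 + v * e1 in
  let x1 := x0 + u1 * e1 - v1 * e2 in let y1 := y0 + u1 * e2 + v1 * e1 in
  P (x1 + r * (x' - x1)) (y1 + r * (y' - y1)).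
Proof.
move=> F hu hv hu1 hv1 r01 /=.
have : P (x0 + (u1 + r * (u - u1)) * e1 - (v1 + r * (v - v1)) * e2)
         (y0 + (u1 + r * (u - u1)) * e2 + (v1 + r * (v - v1)) * e1).
  by apply: F; nra.
congr P; ring.
Qed.

Lemma fits_center (R : realFieldType) (P : R -> R -> Prop) c d x0 y0 e1 e2 :
  0 < c -> 0 < d -> fits P c d x0 y0 e1 e2 -> P x0 y0.
Proof.
move=> c0 d0 F.
have : P (x0 + 0 * e1 - 0 * e2) (y0 + 0 * e2 + 0 * e1) by apply: F; lra.
by congr P; ring.
Qed.

Lemma fits_halfplane (R : realFieldType) (P : R -> R -> Prop)
    al be ga c d x0 y0 e1 e2 u v :
  0 < c -> 0 < d -> fits P c d x0 y0 e1 e2 ->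
  (forall x y, P x y -> al * x + be * y <= ga) ->
  -c <= u * 2 <= c -> -d <= v * 2 <= d ->
  al * (x0 + u * e1 - v * e2) + be * (y0 + u * e2 + v * e1) <= ga.
Proof.
move=> c0 d0 F H hu hv; rewrite leNgt; apply/negP => lt.
have K0 := H _ _ (fits_center c0 d0 F).
set x1 := x0 + _ - _ in lt; set y1 := y0 + _ + _ in lt.
set M := al * x1 + be * y1 in lt.
have ME : M = al * x1 + be * y1 by [].
clearbody M; have D0 : 0 < M - (al * x0 + be * y0) by lra.
(* Going this far towards the center removes half of the excess over [ga], so the point, now in the
   open rectangle, still violates the bound. *)
set r := (M - ga) / (2 * (M - (al * x0 + be * y0))).
have rE : r * (2 * (M - (al * x0 + be * y0))) = M - ga.
  by rewrite /r mulfVK //; lra.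
have r0 : 0 < r by rewrite /r divr_gt0; lra.
have r1 : r <= 1 by rewrite /r ler_pdivrMr ?mul1r; lra.
have : P (x1 + r * (x0 + 0 * e1 - 0 * e2 - x1))
         (y1 + r * (y0 + 0 * e2 + 0 * e1 - y1)).
  by apply: (@fits_segment _ _ c d _ _ _ _ 0 0 u v) => //; lra.
move=> /H; rewrite !mul0r !subr0 !addr0.
have -> : al * (x1 + r * (x0 - x1)) + be * (y1 + r * (y0 - y1)) =
          M - r * (M - (al * x0 + be * y0)) by rewrite ME; ring.
by move=> K; lra.
Qed.

(** The bound is known only over the abscissas in [Q], such as one side of the wall. The open point
    [(u, v)] over [Q] keeps the whole segment over [Q], which is convex. *)
Lemma fits_halfplane_on (R : realFieldType) (P : R -> R -> Prop)
    (Q : R -> bool) al ga c d x0 y0 e1 e2 u v u1 v1 :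
  (forall x x' r, Q x -> Q x' -> 0 < r <= 1 -> Q (x + r * (x' - x))) ->
  fits P c d x0 y0 e1 e2 ->
  (forall x y, P x y -> Q x -> al * y < ga) ->
  -c < u * 2 < c -> -d < v * 2 < d -> -c <= u1 * 2 <= c -> -d <= v1 * 2 <= d ->
  Q (x0 + u * e1 - v * e2) -> Q (x0 + u1 * e1 - v1 * e2) ->
  al * (y0 + u1 * e2 + v1 * e1) <= ga.
Proof.
move=> cvx F H hu hv hu1 hv1; set x' := x0 + u * e1 - _; set x1 := x0 + _ - _.
move=> Qx' Qx1; set y1 := y0 + _ + _; rewrite leNgt; apply/negP => lt.
set y' := y0 + u * e2 + v * e1.
have lt' : al * y' < ga.
  by apply: H Qx'; apply: F.
have D0 : 0 < al * y1 - al * y' by lra.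
(* At this [r] the segment meets the line [al * y = ga], which the strict bound [H] excludes. *)
set r := (al * y1 - ga) / (al * y1 - al * y').
have rE : r * (al * y1 - al * y') = al * y1 - ga by rewrite /r mulfVK //; lra.
have r01 : 0 < r <= 1.
  by rewrite /r divr_gt0 ?ler_pdivrMr /=; lra.
have := @fits_segment _ _ _ _ _ _ _ _ u v _ _ r F hu hv hu1 hv1 r01.
move=> /= /H; rewrite -/x1 -/x' -/y1 -/y' => /(_ (cvx _ _ _ Qx1 Qx' r01)).
nra.
Qed.

(** * The walls of the corridor as bounds on the closed rectangle *)

Lemma region_right (R : realFieldType) (a b : R) i lo hi c d x0 y0 e1 e2 u v :
  0 < c -> 0 < d -> fits (region a b i lo hi) c d x0 y0 e1 e2 ->
  -c <= u * 2 <= c -> -d <= v * 2 <= d -> 0 <= x0 + u * e1 - v * e2.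
Proof.
move=> c0 d0 F hu hv.
have := fits_halfplane (al := -1) (be := 0) (ga := 0) c0 d0 F _ hu hv.
rewrite mul0r addr0 mulN1r oppr_le0; apply=> x y [x0' _ _ _ _]; lra.
Qed.

Lemma region_floor (R : realFieldType) (a b : R) hi c d x0 y0 e1 e2 u v :
  0 < c -> 0 < d -> 0 < b -> fits (region a b true true hi) c d x0 y0 e1 e2 ->
  -c <= u * 2 <= c -> -d <= v * 2 <= d -> 0 <= y0 + u * e2 + v * e1.
Proof.
move=> c0 d0 b0 F hu hv.
have := fits_halfplane (al := 0) (be := -1) (ga := 0) c0 d0 F _ hu hv.
rewrite mul0r add0r mulN1r oppr_le0; apply=> x y [_ D I L _].
by have [/I|/L|/D] := ltgtP x a => //; [move/(_ isT)|move/(_ isT)|]; lra.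
Qed.

Lemma region_left_floor (R : realFieldType) (a b : R) lo hi
    c d x0 y0 e1 e2 u v :
  0 < c -> 0 < d -> 0 < b -> x0 <= a ->
  fits (region a b true lo hi) c d x0 y0 e1 e2 ->
  -c <= u * 2 <= c -> -d <= v * 2 <= d ->
  x0 + u * e1 - v * e2 <= a -> 0 <= y0 + u * e2 + v * e1.
Proof.
move=> c0 d0 b0 x0a F hu hv xa.
have := @fits_halfplane_on _ _ (fun x => x <= a) (-1) 0 _ _ _ _ _ _ 0 0 u v _ F.
rewrite mulN1r oppr_le0; apply => //; try lra; first by move=> *; nra.
move=> x y [_ D I _ _]; rewrite le_eqVlt => /predU1P[/D|/I]; [|move/(_ isT)]; lra.
Qed.

(** On the segment from the center to the given point across the line, the crossing occurs strictly
    before the end, hence in the open rectangle. *)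
Lemma fits_crossing (R : realFieldType) (P : R -> R -> Prop) a
    c d x0 y0 e1 e2 u v u' v' :
  0 < c -> 0 < d -> fits P c d x0 y0 e1 e2 ->
  -c <= u * 2 <= c -> -d <= v * 2 <= d ->
  -c <= u' * 2 <= c -> -d <= v' * 2 <= d ->
  x0 + u * e1 - v * e2 < a -> a < x0 + u' * e1 - v' * e2 ->
  exists u1 v1, [/\ -c < u1 * 2 < c, -d < v1 * 2 < d &
    x0 + u1 * e1 - v1 * e2 = a].
Proof.
move=> c0 d0 F hu hv hu' hv' xa xa'.
have aux (w z : R) : -c <= w * 2 <= c -> -d <= z * 2 <= d ->
    w * e1 - z * e2 != 0 -> 0 <= (a - x0) / (w * e1 - z * e2) < 1 ->
    exists u1 v1, [/\ -c < u1 * 2 < c, -d < v1 * 2 < d &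
      x0 + u1 * e1 - v1 * e2 = a].
  move=> hw hz nz; set r := _ / _ => r01.
  exists (r * w), (r * z); split; [nra|nra|].
  have : r * (w * e1 - z * e2) = a - x0 by rewrite /r mulfVK.
  by move=> rE; transitivity (x0 + r * (w * e1 - z * e2)); [ring|lra].
have [x0a|x0a] := leP x0 a.
  have D0 : 0 < u' * e1 - v' * e2 by lra.
  apply: (aux u' v') => //; first by lra.
  by rewrite divr_ge0 ?ltr_pdivrMr //=; lra.
have D0 : u * e1 - v * e2 < 0 by lra.
apply: (aux u v) => //; first by lra.
rewrite -[a - x0]opprB mulNr -mulrN -invrN.
by rewrite divr_ge0 ?ltr_pdivrMr //=; lra.
Qed.

(** An open point on the line is required: a rectangle that touches the wall only with its boundary
    is not confined to the door. *)
Lemma region_door (R : realFieldType) (a b : R) i lo hi c d x0 y0 e1 e2 u v :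
  fits (region a b i lo hi) c d x0 y0 e1 e2 ->
  (exists u1 v1, [/\ -c < u1 * 2 < c, -d < v1 * 2 < d &
    x0 + u1 * e1 - v1 * e2 = a]) ->
  -c <= u * 2 <= c -> -d <= v * 2 <= d ->
  x0 + u * e1 - v * e2 = a -> 0 <= y0 + u * e2 + v * e1 <= b.
Proof.
move=> F [u1 [v1 [hu1 hv1 x1a]]] hu hv xa.
have cvx x x' r : x == a -> x' == a -> 0 < r <= 1 -> x + r * (x' - x) == a.
  by move=> /eqP-> /eqP-> _; rewrite subrr mulr0 addr0.
have := @fits_halfplane_on _ _ (fun x => x == a) 1 b _ _ _ _ _ _ u1 v1 u v cvx F.
have := @fits_halfplane_on _ _ (fun x => x == a) (-1) 0 _ _ _ _ _ _ u1 v1 u v cvx F.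
rewrite mulN1r mul1r oppr_le0 => -> //; rewrite ?x1a ?xa //=.
  apply=> //; try by rewrite ?x1a ?xa.
  by move=> x y [_ D _ _ _] /eqP/D; lra.
by move=> x y [_ D _ _ _] /eqP/D; lra.
Qed.

(** A boundary point beyond the wall yields an open point with [a <= x], either the center or a
    crossing of the wall; from it the floor and the ceiling extend to the boundary. *)
Lemma region_arm (R : realFieldType) (a b : R) i c d x0 y0 e1 e2 u v u' v' :
  0 < c -> 0 < d -> fits (region a b i true true) c d x0 y0 e1 e2 ->
  -c <= u' * 2 <= c -> -d <= v' * 2 <= d -> a < x0 + u' * e1 - v' * e2 ->
  -c <= u * 2 <= c -> -d <= v * 2 <= d ->
  a <= x0 + u * e1 - v * e2 -> 0 <= y0 + u * e2 + v * e1 <= b.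
Proof.
move=> c0 d0 F hu' hv' xa' hu hv xa.
have [u1 [v1 [hu1 hv1 x1a]]] : exists u1 v1, [/\ -c < u1 * 2 < c,
    -d < v1 * 2 < d & a <= x0 + u1 * e1 - v1 * e2].
  have [x0a|x0a] := leP a x0; first by exists 0, 0; split; lra.
  have [||||||u1 [v1 [hu1 hv1 E]]] :=
    @fits_crossing _ _ a _ _ _ _ _ _ 0 0 u' v' c0 d0 F; try (by []); try lra.
  by exists u1, v1; rewrite E.
have cvx x x' r : a <= x -> a <= x' -> 0 < r <= 1 -> a <= x + r * (x' - x).
  by move=> *; nra.
have := @fits_halfplane_on _ _ (fun x => a <= x) 1 b _ _ _ _ _ _ u1 v1 u v cvx F.
have := @fits_halfplane_on _ _ (fun x => a <= x) (-1) 0 _ _ _ _ _ _ u1 v1 u v cvx F.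
have arm x y : region a b i true true x y -> a <= x -> 0 < y < b.
  move=> [_ D _ L H]; rewrite le_eqVlt => /predU1P[/esym/D//|ax].
  by rewrite L // H.
rewrite mulN1r mul1r oppr_le0 => -> //.
  by apply=> // x y /arm H /H; lra.
by move=> x y /arm H /H; lra.
Qed.

(* The vertical line through the door meets both long sides, so it cuts the
   rectangle in a chord of length d / e1. *)
Lemma region_chord (R : realFieldType) (a b : R) i lo hi c d x0 y0 e1 e2 :
  0 < c -> 0 < d -> fits (region a b i lo hi) c d x0 y0 e1 e2 ->
  e1 ^+ 2 + e2 ^+ 2 = 1 -> 0 < e1 -> x0 <= a -> (a - x0) * 2 < c * e1 ->
  (a - x0) * 2 + d * `|e2| <= c * e1 -> d <= b * e1.
Proof.
move=> c0 d0 F e12 e10 x0a lt le.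
have cross (v : R) : -d <= v * 2 <= d ->
    let u := (a - x0 + v * e2) / e1 in
    (-c <= u * 2 <= c) /\ x0 + u * e1 - v * e2 = a.
  move=> hv u; have uE : u * e1 = a - x0 + v * e2 by rewrite /u mulfVK //; lra.
  split; last by rewrite uE; ring.
  have le2 : `|v * 2 * e2| <= d * `|e2|.
    by rewrite normrM ler_wpM2r // ler_norml.
  move: le2; rewrite ler_norml => le2.
  have h1 : u * 2 * e1 <= c * e1 by lra.
  have h2 : - c * e1 <= u * 2 * e1 by lra.
  by rewrite -(ler_pM2r e10) h2 -(ler_pM2r e10) h1.
(* The long axis crosses the line in the open rectangle because [lt] is strict; [region_door] needs
   such a point. *)
have inner : exists u1 v1, [/\ -c < u1 * 2 < c, -d < v1 * 2 < d &
    x0 + u1 * e1 - v1 * e2 = a].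
  have uE : (a - x0) / e1 * e1 = a - x0 by rewrite mulfVK //; lra.
  exists ((a - x0) / e1), 0; split; last (by rewrite uE; ring); last by lra.
  by set u := _ / _ in uE *; apply/andP; split; nra.
have hv : -d <= d / 2 * 2 <= d by lra.
have hv' : -d <= - (d / 2) * 2 <= d by lra.
have [hu xa] := cross _ hv; have [hu' xa'] := cross _ hv'.
have /andP[_] := region_door F inner hu hv xa.
have /andP[] := region_door F inner hu' hv' xa'.
have uE v : (a - x0 + v * e2) / e1 * e1 = a - x0 + v * e2.
  by rewrite mulfVK //; lra.
move: (uE (d / 2)) (uE (- (d / 2))).
set u := (a - x0 + d / 2 * e2) / e1; set u' := (a - x0 + - (d / 2) * e2) / e1.
move=> E E' h0 _ h1.
have : (u - u') * e1 = d * e2 by rewrite mulrBl E E'; lra.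
move=> Ed.
have -> : d = ((u - u') * e2 + d * e1) * e1.
  rewrite -[LHS]mulr1 -e12 mulrDl mulrAC Ed; ring.
by rewrite ler_pM2r //; lra.
Qed.

(** * Positions blocked by the corner *)

Lemma ladder_sign (R : realFieldType) (a b c d s k : R) :
  0 <= s -> 0 <= k -> 0 < d -> c * d <= a * b ->
  a * s + b * k - c * s * k < d -> 0 < (d - a * s) * (d - b * k).
Proof.
move=> s0 k0 d0 cd lt.
have : 0 <= s * k * (a * b - c * d) by rewrite !mulr_ge0 // subr_ge0.
have : 0 < d * (d - (a * s + b * k - c * s * k)) by rewrite mulr_gt0 // subr_gt0.
lra.
Qed.

(* The upper long side of a rectangle sloping down to the right passes below
   the inner corner (a, b). *)
Lemma region_upper_side (R : realFieldType) (a b : R) i lo hi c d x0 y0 s k :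
  0 < c -> 0 < d -> 0 < s -> 0 < k -> s ^+ 2 + k ^+ 2 = 1 ->
  fits (region a b i lo hi) c d x0 y0 k (- s) ->
  (x0 - a) * 2 <= c * k - d * s -> (a - x0) * 2 < c * k + d * s ->
  s * x0 + k * y0 + d / 2 <= a * s + b * k.
Proof.
move=> c0 d0 s0 k0 sk F UL UR.
have inner := @fits_crossing _ _ a _ _ _ _ _ _
  (- (c / 2)) (- (d / 2)) (c / 2) (d / 2) c0 d0 F.
have {}inner : exists u1 v1, [/\ -c < u1 * 2 < c, -d < v1 * 2 < d &
    x0 + u1 * k - v1 * - s = a].
  have ds : 0 < d * s by rewrite mulr_gt0.
  by apply: inner; lra.
set u := (a - x0 - d / 2 * s) / k.
have uE : u * k = a - x0 - d / 2 * s by rewrite /u mulfVK //; lra.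
have hu : -c <= u * 2 <= c.
  have h1 : u * 2 * k <= c * k by lra.
  have h2 : - c * k <= u * 2 * k by lra.
  by rewrite -(ler_pM2r k0) h2 -(ler_pM2r k0) h1.
have hv : -d <= d / 2 * 2 <= d by lra.
have /andP[_ le] : 0 <= y0 + u * - s + d / 2 * k <= b.
  by apply: (region_door F inner hu hv); lra.
have : (y0 + u * - s + d / 2 * k) * k <= b * k by rewrite ler_pM2r.
have -> : (y0 + u * - s + d / 2 * k) * k =
  y0 * k - s * (u * k) + d / 2 * k ^+ 2 by ring.
have -> : k ^+ 2 = 1 - s ^+ 2 by lra.
by rewrite uE; lra.
Qed.

(** If the inequality fails for a ladder of length [c] and thickness [d], it also fails for the
    perpendicular ladder of length [d] and thickness [c]. For [s <= k], the difference multiplied by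
    [k] is the sum of two nonnegative terms and of [s] times the given failure; exchanging the axes
    settles the other case. *)
Lemma ladder_swap_lt (R : realFieldType) (a b c d s k : R) :
  0 < s -> 0 < k -> s ^+ 2 + k ^+ 2 = 1 -> 0 < d -> d <= c -> a < c -> b < c ->
  a * s + b * k - c * s * k < d -> a * k + b * s < c + d * s * k.
Proof.
move=> s0 k0 sk d0 dc; wlog sk' : a b s k s0 k0 sk / s <= k => [W|].
  move=> ac bc lt; have [/W|/ltW/W] := leP s k; first exact.
  by move=> /(_ b a k0 s0); rewrite addrC => /(_ sk bc ac); lra.
move=> ac bc lt.
have k1 : k < 1 by nra.
rewrite -subr_gt0 -(pmulr_rgt0 _ k0).
have h1 : 0 <= (1 - k) * (c * (k + s ^+ 2) - d * s * (1 + k)).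
  rewrite mulr_ge0 ?subr_ge0 //; first lra.
  apply: (@le_trans _ _ (c * (s * (1 + k)))); first by rewrite -mulrA ler_wpM2r //; nra.
  rewrite ler_pM2l; last lra.
  by rewrite -subr_ge0 (_ : _ - _ = (k - s) * (1 - s)) ?mulr_ge0; [|lra|nra|ring].
have h2 : 0 <= (k ^+ 2 - s ^+ 2) * (c - a).
  by rewrite mulr_ge0 ?subr_ge0 ?lerXn2r ?nnegrE; lra.
have h3 : 0 < s * (d + c * s * k - a * s - b * k) by rewrite mulr_gt0 //; lra.
have -> : k * (c + d * s * k - (a * k + b * s)) =
  (1 - k) * (c * (k + s ^+ 2) - d * s * (1 + k)) + (k ^+ 2 - s ^+ 2) * (c - a)
  + s * (d + c * s * k - a * s - b * k).
  ring.
by apply: ltr_wpDl => //; apply: addr_ge0.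
Qed.

Lemma fits_abs (R : realFieldType) (P : R -> R -> Prop) c d x0 y0 e1 e2 :
  fits P c d x0 y0 e1 e2 ->
  fits P c d x0 y0 `|e1| (- `|e2|) \/ fits P c d x0 y0 `|e1| `|e2|.
Proof.
move=> F; have F' := fits_opp F.
case: (ger0P e1) => _; case: (ger0P e2) => _; rewrite ?opprK in F F' *; tauto.
Qed.

(** Sloping down to the right, the rectangle is a ladder, or the wall cuts both long sides in a
    chord of length [d / k > b]. Sloping up, its right short side takes the place of the ladder,
    with thickness [c], which [ladder_swap_lt] excludes. *)
Lemma blocked_corner_left (R : realFieldType) (a b c d s k : R) lo hi x0 y0 e1 e2 :
  0 < b -> 0 < s -> 0 < k -> s ^+ 2 + k ^+ 2 = 1 -> 0 < d -> d <= b ->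
  a < c -> b < c -> a * s < d -> b * k < d ->
  a * s + b * k - c * s * k < d ->
  `|e1| = k -> `|e2| = s -> x0 <= a ->
  ~ fits (region a b true lo hi) c d x0 y0 e1 e2.
Proof.
move=> b0 s0 k0 sk d0 db ac bc asd bkd lt e1k e2s x0a F.
have c0 : 0 < c by lra.
have k1 : k < 1 by nra.
have s1 : s < 1 by nra.
have ds : 0 < d * s by rewrite mulr_gt0.
have ck : 0 < c * k by rewrite mulr_gt0.
have bs : b * s < c by nra.
(* The rectangle is wider than the left part; as it has no point with [x < 0], it reaches beyond the
   wall. *)
have wide : a < c * k + d * s.
  rewrite -(ltr_pM2r s0); have : b * k < d * k ^+ 2 + (d * s ^+ 2 + c * s * k - a * s) by nra.
  have : d * k ^+ 2 + d * s ^+ 2 = d by rewrite -mulrDr addrC sk mulr1.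
  nra.
have hv : -d <= d / 2 * 2 <= d by lra.
have hv' : -d <= - (d / 2) * 2 <= d by lra.
have hu : -c <= c / 2 * 2 <= c by lra.
have hu' : -c <= - (c / 2) * 2 <= c by lra.
(* A vertical line meeting both short sides would cut a chord of length [c / s], which exceeds
   [b]. *)
have short : fits (region a b true lo hi) d c x0 y0 s k \/
             fits (region a b true lo hi) d c x0 y0 s (- k) ->
             c * k <= d * s -> (a - x0) * 2 <= d * s - c * k -> False.
  move=> F2 cd le; suff : c <= b * s by lra.
  case: F2 => F2; apply: (region_chord d0 c0 F2) => //; rewrite ?normrN ?sqrrN //;
    by rewrite ?(ger0_norm (ltW k0)); lra.
have [{}F|{}F] := fits_abs F; rewrite e1k e2s in F.
- have F2 := fits_turn F; rewrite opprK in F2.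
  have UL : (x0 - a) * 2 <= c * k - d * s.
    rewrite leNgt; apply/negP => UL.
    by apply: short; [left|lra|lra].
  have LL := region_right c0 d0 F hu' hv'.
  have top := region_upper_side c0 d0 s0 k0 sk F UL (_ : _).
  have {}top : s * x0 + k * y0 + d / 2 <= a * s + b * k by apply: top; lra.
  (* If the lower long side ends before the wall, its left end has [0 <= x], its right end has
     [0 <= y], and with [top] this is the ladder inequality. *)
  have [LR|LR] := leP (x0 + c / 2 * k - - (d / 2) * - s) a.
    have fl := region_left_floor c0 d0 b0 x0a F hu hv' LR.
    have := mulr_ge0 (ltW s0) LL; have := mulr_ge0 (ltW k0) fl.
    have -> : k * (y0 + c / 2 * - s + - (d / 2) * k) =
      k * y0 - c / 2 * s * k - d / 2 * (1 - s ^+ 2) by rewrite -sk; ring.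
    lra.
  (* Otherwise the line [x = a] meets both long sides, and the chord gives [d <= b * k]. *)
  set u := (a - x0 + d / 2 * s) / k.
  have uE : u * k = a - x0 + d / 2 * s by rewrite /u mulfVK //; lra.
  have {}hu : -c <= u * 2 <= c.
    have h1 : u * 2 * k <= c * k by lra.
    have h2 : - c * k <= u * 2 * k by lra.
    by rewrite -(ler_pM2r k0) h2 -(ler_pM2r k0) h1.
  have fl := region_left_floor c0 d0 b0 x0a F hu hv' (_ : _).
  have {}fl : 0 <= y0 + u * - s + - (d / 2) * k by apply: fl; lra.
  have := mulr_ge0 (ltW k0) fl.
  have -> : k * (y0 + u * - s + - (d / 2) * k) =
    k * y0 - s * (u * k) - d / 2 * (1 - s ^+ 2) by rewrite -sk; ring.
  by rewrite uE; lra.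
- have F2 := fits_turn (fits_opp F); rewrite opprK in F2.
  have LLa : (x0 - a) * 2 <= c * k - d * s.
    rewrite leNgt; apply/negP => LLa.
    by apply: short; [right|lra|lra].
  have UL := region_right c0 d0 F hu' hv.
  have fl := region_left_floor c0 d0 b0 x0a F hu' hv' (_ : _).
  have {}fl : 0 <= y0 + - (c / 2) * s + - (d / 2) * k by apply: fl; lra.
  have UR : x0 + c / 2 * k - d / 2 * s < a.
    rewrite ltNge; apply/negP => UR.
    suff : d <= b * k by lra.
    by apply: (region_chord c0 d0 F); rewrite ?(ger0_norm (ltW s0)); lra.
  set v := (x0 + c / 2 * k - a) / s.
  have vE : v * s = x0 + c / 2 * k - a by rewrite /v mulfVK //; lra.
  have {}hv : -d <= v * 2 <= d.
    have h1 : v * 2 * s <= d * s by lra.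
    have h2 : - d * s <= v * 2 * s by lra.
    by rewrite -(ler_pM2r s0) h2 -(ler_pM2r s0) h1.
  have /andP[_ top] : 0 <= y0 + c / 2 * s + v * k <= b.
    apply: (region_door F _ hu hv); last by lra.
    apply: (@fits_crossing _ _ a _ _ _ _ _ _
      (- (c / 2)) (d / 2) (c / 2) (- (d / 2)) c0 d0 F); lra.
  (* The ladder inequality with the sides exchanged: the leftmost corner has [0 <= x], the lowest
     has [0 <= y], and the right short side meets [x = a] at height at most [b]. *)
  have : c + d * s * k <= a * k + b * s.
    have : s * (y0 + c / 2 * s + v * k) <= s * b by rewrite ler_pM2l.
    have -> : s * (y0 + c / 2 * s + v * k) = s * y0 + c / 2 * s ^+ 2 + k * (v * s).
      by ring.
    rewrite vE; have := mulr_ge0 (ltW k0) UL; have := mulr_ge0 (ltW s0) fl.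
    nra.
  by have := @ladder_swap_lt _ a b c d s k s0 k0 sk d0 _ ac bc lt; lra.
Qed.

(** Without a floor on the left the region is symmetric under [y |-> b - y], so the slope may be
    taken downwards. The right corners lie in the arm because [a < c * k], the upper left one does
    not because [b < c * s]; hence the rectangle is a ladder between the wall [x = 0] and the floor
    of the arm. *)
Lemma blocked_corner_arm (R : realFieldType) (a b c d s k : R) x0 y0 e1 e2 :
  0 < c -> 0 < d -> 0 < s -> 0 < k -> s ^+ 2 + k ^+ 2 = 1 ->
  a < c * k -> b < c * s -> a * s + b * k - c * s * k < d ->
  `|e1| = k -> `|e2| = s ->
  ~ fits (region a b false true true) c d x0 y0 e1 e2.
Proof.
move=> c0 d0 s0 k0 sk ack bcs lt e1k e2s F.
have {F} [y1 F] : exists y1, fits (region a b false true true) c d x0 y1 k (- s).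
  have [F'|F'] := fits_abs F; rewrite e1k e2s in F'; first by exists y0.
  exists (b - y0); apply: fits_mirror F' => x y [x1 D _ L H]; split=> //.
  - by move=> /D; lra.
  - by move=> _ /H; move/(_ isT); lra.
  - by move=> _ /L; move/(_ isT); lra.
have ds : 0 < d * s by rewrite mulr_gt0.
have dk : 0 < d * k by rewrite mulr_gt0.
have hv : -d <= d / 2 * 2 <= d by lra.
have hv' : -d <= - (d / 2) * 2 <= d by lra.
have hu : -c <= c / 2 * 2 <= c by lra.
have hu' : -c <= - (c / 2) * 2 <= c by lra.
have LL := region_right c0 d0 F hu' hv'.
have UR : a < x0 + c / 2 * k - d / 2 * - s by lra.
have LR : a < x0 + c / 2 * k - - (d / 2) * - s by lra.
have LRa := ltW LR.
have /andP[fl _] := region_arm c0 d0 F hu hv UR hu hv' LRa.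
have [ULa|ULa] := leP a (x0 + - (c / 2) * k - d / 2 * - s).
  have /andP[_ le] := region_arm c0 d0 F hu hv UR hu' hv ULa.
  by lra.
have top : s * x0 + k * y1 + d / 2 <= a * s + b * k.
  by apply: (region_upper_side c0 d0 s0 k0 sk F); lra.
have := mulr_ge0 (ltW s0) LL; have := mulr_ge0 (ltW k0) fl.
have -> : k * (y1 + c / 2 * - s + - (d / 2) * k) =
  k * y1 - c / 2 * s * k - d / 2 * (1 - s ^+ 2) by rewrite -sk; ring.
lra.
Qed.

(* In the quarter plane, when the long axis is turned to the critical slope the
   upper end of the rectangle cannot be on the left of the wall. *)
Lemma blocked_corner_quarter (R : realFieldType) (a b c d s k : R) hi x0 y0 e1 :
  0 < b -> 0 < c -> 0 < d -> 0 < s -> 0 < k -> s ^+ 2 + k ^+ 2 = 1 ->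
  a < c * k -> b < c * s -> a * s + b * k - c * s * k < d ->
  `|e1| = k -> x0 + c / 2 * e1 <= a ->
  ~ fits (region a b true true hi) c d x0 y0 e1 s.
Proof.
move=> b0 c0 d0 s0 k0 sk ack bcs lt e1k Ga F.
have ds : 0 < d * s by rewrite mulr_gt0.
have dk : 0 < d * k by rewrite mulr_gt0.
have hv : -d <= d / 2 * 2 <= d by lra.
have hv' : -d <= - (d / 2) * 2 <= d by lra.
have hv0 : -d <= 0 * 2 <= d by lra.
have hu : -c <= c / 2 * 2 <= c by lra.
have hu' : -c <= - (c / 2) * 2 <= c by lra.
have e1E : e1 = k \/ e1 = - k.
  by move: e1k; case: (ger0P e1) => _ <-; [left|right; rewrite opprK].
case: e1E => {e1k} e1E; rewrite {e1}e1E in Ga F.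
  by have := region_right c0 d0 F hu' hv0; lra.
have {}F := fits_opp F; rewrite opprK in F.
have LL := region_right c0 d0 F hu' hv'.
have fl := region_floor c0 d0 b0 F hu hv'.
have [UL|UL] := leP (x0 + - (c / 2) * k - d / 2 * - s) a.
  have top : s * x0 + k * y0 + d / 2 <= a * s + b * k.
    by apply: (region_upper_side c0 d0 s0 k0 sk F); lra.
  have := mulr_ge0 (ltW s0) LL; have := mulr_ge0 (ltW k0) fl.
  have -> : k * (y0 + c / 2 * - s + - (d / 2) * k) =
    k * y0 - c / 2 * s * k - d / 2 * (1 - s ^+ 2) by rewrite -sk; ring.
  lra.
(* Here the wall cuts the upper end between its midpoint and its higher corner, at a height of at
   least [c * s], hence above [b]. *)
set v := (a - x0 + c / 2 * k) / s.
have vE : v * s = a - x0 + c / 2 * k by rewrite /v mulfVK //; lra.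
have v0 : 0 <= v by rewrite -(pmulr_lge0 _ s0) vE; lra.
have {}hv0 : -d <= v * 2 <= d.
  have h1 : v * 2 * s <= d * s by lra.
  by apply/andP; split; [lra|rewrite -(ler_pM2r s0) h1].
have /andP[_ top] : 0 <= y0 + - (c / 2) * - s + v * k <= b.
  apply: (region_door F _ hu' hv0); last by lra.
  by apply: (@fits_crossing _ _ a _ _ _ _ _ _
    (- (c / 2)) (- (d / 2)) (- (c / 2)) (d / 2) c0 d0 F); lra.
by have := mulr_ge0 v0 (ltW k0); lra.
Qed.

(** The midpoint of the lower end is not below the floor, so that of the upper end, in the line of
    the door, is higher than [b]. *)
Lemma blocked_door_quarter (R : realFieldType) (a b c d : R) hi x0 y0 e1 e2 :
  0 < b -> 0 < c -> 0 < d -> 0 < e2 -> b < c * e2 -> x0 + c / 2 * e1 = a ->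
  ~ fits (region a b true true hi) c d x0 y0 e1 e2.
Proof.
move=> b0 c0 d0 e20 bce Ga F.
have de : 0 < d * e2 by rewrite mulr_gt0.
have hu : -c <= c / 2 * 2 <= c by lra.
have hu' : -c <= - (c / 2) * 2 <= c by lra.
have hv0 : -d <= 0 * 2 <= d by lra.
have fl := region_floor c0 d0 b0 F hu' hv0.
have /andP[_ top] : 0 <= y0 + c / 2 * e2 + 0 * e1 <= b.
  apply: (region_door F _ hu hv0); last by lra.
  by apply: (@fits_crossing _ _ a _ _ _ _ _ _
    (c / 2) (d / 2) (c / 2) (- (d / 2)) c0 d0 F); lra.
by lra.
Qed.

(** * Extent of the rectangle and its chord through the center *)

Lemma fits_width (R : realFieldType) (P : R -> R -> Prop) a c d x0 y0 e1 e2 :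
  0 < c -> 0 < d -> fits P c d x0 y0 e1 e2 ->
  (forall x y, P x y -> 0 < x <= a) ->
  (c * `|e1| + d * `|e2| <= x0 * 2) /\ (c * `|e1| + d * `|e2| <= (a - x0) * 2).
Proof.
move=> c0 d0 F H.
have hv : -d <= d / 2 * 2 <= d by lra.
have hv' : -d <= - (d / 2) * 2 <= d by lra.
have hu : -c <= c / 2 * 2 <= c by lra.
have hu' : -c <= - (c / 2) * 2 <= c by lra.
have lo x y : P x y -> -1 * x + 0 * y <= 0 by move=> /H; lra.
have hi x y : P x y -> 1 * x + 0 * y <= a by move=> /H; lra.
have [F'|F'] := fits_abs F.
  have := fits_halfplane c0 d0 F' lo hu' hv'.
  by have := fits_halfplane c0 d0 F' hi hu hv; lra.
have := fits_halfplane c0 d0 F' lo hu' hv.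
by have := fits_halfplane c0 d0 F' hi hu hv'; lra.
Qed.

Lemma fits_height (R : realFieldType) (P : R -> R -> Prop) b c d x0 y0 e1 e2 :
  0 < c -> 0 < d -> fits P c d x0 y0 e1 e2 ->
  (forall x y, P x y -> 0 < y < b) -> c * `|e2| + d * `|e1| <= b.
Proof.
move=> c0 d0 F H.
have F' : fits (fun x y => P y x) c d y0 x0 e2 e1.
  move=> u v hu hv; have : P (x0 + u * e1 - (- v) * e2) (y0 + u * e2 + (- v) * e1).
    by apply: F; lra.
  by congr P; ring.
have H' x y : P y x -> 0 < x <= b by move=> /H; lra.
by have [] := fits_width c0 d0 F' H'; lra.
Qed.

Lemma fits_right (R : realFieldType) (P : R -> R -> Prop) c d x0 y0 e1 e2 :
  0 < c -> 0 < d -> fits P c d x0 y0 e1 e2 ->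
  (forall x y, P x y -> 0 < x) -> c * `|e1| + d * `|e2| <= x0 * 2.
Proof.
move=> c0 d0 F H.
have hv : -d <= d / 2 * 2 <= d by lra.
have hv' : -d <= - (d / 2) * 2 <= d by lra.
have hu' : -c <= - (c / 2) * 2 <= c by lra.
have lo x y : P x y -> -1 * x + 0 * y <= 0 by move=> /H; lra.
have [F'|F'] := fits_abs F.
  by have := fits_halfplane c0 d0 F' lo hu' hv'; lra.
by have := fits_halfplane c0 d0 F' lo hu' hv; lra.
Qed.

Lemma unit_norm_ge1 (R : realFieldType) (x y : R) :
  x ^+ 2 + y ^+ 2 = 1 -> 1 <= `|x| + `|y|.
Proof.
rewrite -(real_normK (num_real x)) -(real_normK (num_real y)).
have := normr_ge0 x; have := normr_ge0 y.
by move: `|x| `|y| => p q *; nra.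
Qed.

Lemma unit_norm_le1 (R : realFieldType) (x y : R) :
  x ^+ 2 + y ^+ 2 = 1 -> `|x| <= 1.
Proof.
rewrite -(real_normK (num_real x)) -(real_normK (num_real y)).
have := normr_ge0 x; have := normr_ge0 y.
by move: `|x| `|y| => p q *; nra.
Qed.

Lemma unit_norm_eq (R : realFieldType) (x y s k : R) :
  x ^+ 2 + y ^+ 2 = 1 -> s ^+ 2 + k ^+ 2 = 1 -> 0 <= s -> `|x| = k -> `|y| = s.
Proof.
move=> xy sk s0 xk; apply/eqP; rewrite -(eqrXn2 (ltn0Sn 1)) ?normr_ge0 //.
rewrite real_normK ?num_real //; move: xy.
by rewrite -(real_normK (num_real x)) xk => xy; apply/eqP; lra.
Qed.

Lemma region_chord_abs (R : realFieldType) (a b : R) i lo hi c d x0 y0 e1 e2 :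
  0 < c -> 0 < d -> fits (region a b i lo hi) c d x0 y0 e1 e2 ->
  e1 ^+ 2 + e2 ^+ 2 = 1 -> x0 <= a -> (a - x0) * 2 < c * `|e1| ->
  (a - x0) * 2 + d * `|e2| <= c * `|e1| -> d <= b * `|e1|.
Proof.
move=> c0 d0 F e12 x0a lt le.
have e10 : 0 < `|e1| by rewrite -(pmulr_rgt0 _ c0); lra.
by have [{}F|{}F] := fits_abs F; apply: (region_chord c0 d0 F);
  rewrite ?sqrrN ?real_normK ?num_real ?normrN ?normr_id.
Qed.

(** Depending on the slope, the vertical line through the center meets both long sides or both short
    sides; in either case the chord has to fit into the door. *)
Lemma region_center_chord (R : realFieldType) (a b : R) i lo hi c d y0 e1 e2 :
  0 < c -> 0 < d -> fits (region a b i lo hi) c d a y0 e1 e2 ->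
  e1 ^+ 2 + e2 ^+ 2 = 1 -> d <= b * `|e1| \/ c <= b * `|e2|.
Proof.
move=> c0 d0 F e12; have := unit_norm_ge1 e12.
have := normr_ge0 e1; have := normr_ge0 e2 => p q pq.
have cp : 0 <= c * `|e1| by rewrite mulr_ge0 // ltW.
have dq : 0 <= d * `|e2| by rewrite mulr_ge0 // ltW.
have [le|lt] := leP (d * `|e2|) (c * `|e1|); [left|right].
  apply: (region_chord_abs c0 d0 F) => //; rewrite ?subrr ?mul0r ?add0r //.
  rewrite pmulr_rgt0 // lt_neqAle eq_sym q andbT; apply/eqP => e10.
  by move: le; rewrite e10 mulr0 pmulr_rle0 //; lra.
have {}F := fits_turn F.
by rewrite -normrN; apply: (region_chord_abs d0 c0 F);
  rewrite ?sqrrN ?normrN 1?addrC //; lra.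
Qed.

(** * Necessary conditions along a journey *)

(* Only for B_3, that is for [lo && hi], are bounds on the height needed at the
   end of the motion. *)
Definition journey {R : realType} (a b : R) (i lo hi : bool) (c d : R) (x0 y0 e1 e2 : R -> R) := [/\
  [/\ {within `[0, 1], continuous x0}, {within `[0, 1], continuous y0},
      {within `[0, 1], continuous e1} & {within `[0, 1], continuous e2}],
  forall t, 0 <= t <= 1 -> e1 t ^+ 2 + e2 t ^+ 2 = 1,
  forall t, 0 <= t <= 1 ->
    fits (region a b i lo hi) c d (x0 t) (y0 t) (e1 t) (e2 t),
  fits (fun x _ => 0 < x <= a) c d (x0 0) (y0 0) (e1 0) (e2 0) &
  fits (fun x y => a <= x /\ (lo && hi -> 0 < y < b)) c d
    (x0 1) (y0 1) (e1 1) (e2 1)].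

Lemma crossing_time (R : realType) (f : R -> R) :
  {within `[0, 1], continuous f} -> 0 <= f 0 -> f 1 <= 0 ->
  exists2 t, 0 <= t <= 1 & f t = 0.
Proof.
move=> cf f0 f1; have [|t] := @IVT R f 0 1 0 ler01 cf.
  by rewrite ge_min le_max f0 f1 orbT.
by rewrite in_itv /= => t01 ft; exists t.
Qed.

(** The intermediate value theorem is applied to the minimum: where it vanishes, one function is
    zero and the other still nonnegative. *)
Lemma crossing_time_min (R : realType) (f g : R -> R) :
  {within `[0, 1], continuous f} -> {within `[0, 1], continuous g} ->
  0 <= f 0 -> 0 <= g 0 -> f 1 <= 0 \/ g 1 <= 0 ->
  exists2 t, 0 <= t <= 1 & f t = 0 /\ 0 <= g t \/ 0 <= f t /\ g t = 0.
Proof.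
move=> cf cg f0 g0 fg1.
have [|||t t01] := @crossing_time R (fun t => Num.min (f t) (g t)).
- by move=> t; apply: continuous_min; [exact: cf|exact: cg].
- by rewrite le_min f0 g0.
- by rewrite ge_min; case: fg1 => ->; rewrite ?orbT.
case: (leP (f t) (g t)) => h E; exists t => //.
  by left; rewrite -E.
by right; rewrite -E ltW.
Qed.

Lemma journey_start_width (R : realType) (a b : R) i lo hi c d x0 y0 e1 e2 :
  0 < c -> 0 < d -> journey a b i lo hi c d x0 y0 e1 e2 ->
  c * `|e1 0| + d * `|e2 0| <= (a - x0 0) * 2 /\ c * `|e1 0| + d * `|e2 0| <= a.
Proof.
move=> c0 d0 [_ _ _ F _].
by have [] := fits_width c0 d0 F (fun _ _ H => H); split; lra.
Qed.

Lemma journey_end (R : realType) (a b : R) i lo hi c d x0 y0 e1 e2 :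
  0 < c -> 0 < d -> journey a b i lo hi c d x0 y0 e1 e2 -> a <= x0 1.
Proof. by move=> c0 d0 [_ _ _ _ F]; have [] := fits_center c0 d0 F. Qed.

(** The width at the start bounds [d] by [a]; the chord through the center, when the center passes
    the door, bounds [d] by [b]. *)
Lemma journey_door (R : realType) (a b : R) i lo hi c d x0 y0 e1 e2 :
  0 < d -> d <= c -> 0 < b -> journey a b i lo hi c d x0 y0 e1 e2 ->
  d <= a /\ d <= b.
Proof.
move=> d0 dc b0 J; have c0 : 0 < c by lra.
have [sw1 sw2] := journey_start_width c0 d0 J; have xe := journey_end c0 d0 J.
case: J => [[cx _ _ _] u F _ _].
have n0 := unit_norm_ge1 (u 0 _).
have {}n0 : 1 <= `|e1 0| + `|e2 0| by apply: n0; rewrite lexx ler01.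
have := normr_ge0 (e1 0); have := normr_ge0 (e2 0) => q0 p0.
split; first by nra.
have [|||t t01 xt] := @crossing_time R (fun t => a - x0 t).
- by move=> t; apply: cvgB; [exact: cvg_cst|exact: cx].
- by nra.
- by lra.
have := F t t01; rewrite (_ : x0 t = a); last by lra.
have ut := u t t01; have e1n := unit_norm_le1 ut.
have e2n : `|e2 t| <= 1 by apply: (@unit_norm_le1 _ _ (e1 t)); rewrite addrC.
by move=> /(region_center_chord c0 d0) /(_ ut) []; nra.
Qed.

(** Were the area larger, some [kap] would satisfy [a / c < kap < d / b], and the rectangle starts
    steeper than [kap]. While this lasts its center cannot pass the door; and at [kap] itself, with
    the center on the left, the wall already cuts both long sides in too long a chord. *)
Lemma journey_area (R : realType) (a b : R) i lo hi c d x0 y0 e1 e2 :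
  0 < d -> d <= c -> 0 < b -> journey a b i lo hi c d x0 y0 e1 e2 ->
  c * d <= a * b.
Proof.
move=> d0 dc b0 J; have c0 : 0 < c by lra.
rewrite leNgt; apply/negP => lt.
have [sw1 sw2] := journey_start_width c0 d0 J; have xe := journey_end c0 d0 J.
have [da db] := journey_door d0 dc b0 J.
case: J => [[cx _ ce _] u F _ _].
have [kap ak kd] : exists2 k, a < c * k & b * k < d.
  have lt' : a / c < d / b by rewrite ltr_pdivrMr // mulrAC ltr_pdivlMr //; lra.
  exists ((a / c + d / b) / 2).
    by rewrite mulrC -ltr_pdivrMr //; lra.
  by rewrite mulrC -ltr_pdivlMr //; lra.
have := normr_ge0 (e1 0); have := normr_ge0 (e2 0) => q0 p0.
have [|||||t t01 H] := @crossing_time_min R (fun t => a - x0 t) (fun t => kap - `|e1 t|).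
- by move=> t; apply: cvgB; [exact: cvg_cst|exact: cx].
- by move=> t; apply: cvgB; [exact: cvg_cst|apply: cvg_norm; exact: ce].
- by nra.
- by nra.
- by left; lra.
have ut := u t t01; have e1n := unit_norm_le1 ut.
have e2n : `|e2 t| <= 1 by apply: (@unit_norm_le1 _ _ (e1 t)); rewrite addrC.
have Ft := F t t01.
case: H => [[xt et]|[xt et]].
  move: Ft; rewrite (_ : x0 t = a); last by lra.
  move=> /(region_center_chord c0 d0) /(_ ut) [le|le].
    have : b * `|e1 t| <= b * kap by rewrite ler_pM2l //; lra.
    lra.
  have le2 : b * `|e2 t| <= b by rewrite ler_piMr // ltW.
  have : c * d <= b * a by apply: ler_pM; lra.
  lra.
have xw : c * `|e1 t| + d * `|e2 t| <= x0 t * 2.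
  by apply: (fits_right c0 d0 Ft) => x y [].
have := normr_ge0 (e2 t) => q1.
suff : d <= b * `|e1 t| by nra.
by apply: (region_chord_abs c0 d0 Ft) => //; nra.
Qed.


(** The rectangle starts at least as steep as [k]. So steep, its center cannot pass the door,
    because [b * k < d] and [b < c]; so the slope [k] occurs with the center on the left, where
    [blocked_corner_left] applies. *)
Lemma journey_left_slope (R : realType) (a b : R) lo hi c d x0 y0 e1 e2 (s k : R) :
  0 < d -> d <= c -> 0 < a -> 0 < b -> a < c -> b < c ->
  0 <= s -> 0 <= k -> s ^+ 2 + k ^+ 2 = 1 -> a * s < d -> b * k < d ->
  journey a b true lo hi c d x0 y0 e1 e2 -> d <= a * s + b * k - c * s * k.
Proof.
move=> d0 dc a0 b0 ac bc s0 k0 sk asd bkd J; have c0 : 0 < c by lra.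
rewrite leNgt; apply/negP => lt.
have [sw1 sw2] := journey_start_width c0 d0 J; have xe := journey_end c0 d0 J.
have [da db] := journey_door d0 dc b0 J.
case: J => [[cx _ ce _] u F _ _].
have s1 : s < 1 by rewrite -(ltr_pM2l a0); lra.
have k1 : k < 1 by rewrite -(ltr_pM2l b0); lra.
have {}s0 : 0 < s by nra.
have {}k0 : 0 < k by nra.
(* A flatter start, with [k < K] and [S < s], would give [d * (1 + K) < a * S < a * s < d]. *)
have start : `|e1 0| <= k.
  rewrite leNgt; apply/negP => kK.
  have := u 0 _; rewrite lexx ler01 => /(_ isT).
  rewrite -(real_normK (num_real (e1 0))) -(real_normK (num_real (e2 0))).
  have := normr_ge0 (e1 0); have := normr_ge0 (e2 0).
  move: `|e1 0| `|e2 0| kK sw1 sw2 => K S kK sw1 sw2 S0 K0 KS.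
  have K1 : K < 1 by nra.
  have {}S0 : 0 < S by nra.
  have Ss : S < s by nra.
  have : d * S < a * (1 - K) by nra.
  have : 0 < 1 + K by lra.
  move=> K2 dS.
  have : d * S * (1 + K) < a * (1 - K) * (1 + K) by rewrite ltr_pM2r //; nra.
  have -> : a * (1 - K) * (1 + K) = a * S * S.
    by rewrite -!mulrA; congr (_ * _); lra.
  rewrite mulrAC ltr_pM2r //; nra.
have := normr_ge0 (e1 0); have := normr_ge0 (e2 0) => q0 p0.
have [|||||t t01 H] := @crossing_time_min R (fun t => a - x0 t) (fun t => k - `|e1 t|).
- by move=> t; apply: cvgB; [exact: cvg_cst|exact: cx].
- by move=> t; apply: cvgB; [exact: cvg_cst|apply: cvg_norm; exact: ce].
- by nra.
- by lra.
- by left; lra.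
have ut := u t t01; have e1n := unit_norm_le1 ut.
have e2n : `|e2 t| <= 1 by apply: (@unit_norm_le1 _ _ (e1 t)); rewrite addrC.
have Ft := F t t01.
case: H => [[xt et]|[xt et]].
  move: Ft; rewrite (_ : x0 t = a); last by lra.
  move=> /(region_center_chord c0 d0) /(_ ut) [le|le].
    have : b * `|e1 t| <= b * k by rewrite ler_pM2l //; lra.
    lra.
  have le2 : b * `|e2 t| <= b by rewrite ler_piMr // ltW.
  lra.
have e1k : `|e1 t| = k by lra.
have e2s := unit_norm_eq ut sk (ltW s0) e1k.
apply: (blocked_corner_left b0 s0 k0 sk d0 db ac bc asd bkd lt e1k e2s _ Ft).
by lra.
Qed.


(** If the inequality fails, then [a < c * k] and [b < c * s]. The width [a] makes the rectangle
    steeper than [k] at the start and the height [b] makes it flatter at the end, so it passes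
    through the slope [k]. *)
Lemma journey_arm_slope (R : realType) (a b : R) c d x0 y0 e1 e2 (s k : R) :
  0 < c -> 0 < d -> 0 < a -> 0 < b ->
  0 <= s -> 0 <= k -> s ^+ 2 + k ^+ 2 = 1 -> d < a * s -> d < b * k ->
  journey a b false true true c d x0 y0 e1 e2 -> d <= a * s + b * k - c * s * k.
Proof.
move=> c0 d0 a0 b0 s0 k0 sk asd bkd J.
rewrite leNgt; apply/negP => lt.
have [sw1 sw2] := journey_start_width c0 d0 J.
case: J => [[cx _ ce _] u F _ Fe].
have {}s0 : 0 < s by nra.
have {}k0 : 0 < k by nra.
have ack : a < c * k by rewrite -(ltr_pM2r s0); lra.
have bcs : b < c * s by rewrite -(ltr_pM2r k0); lra.
have eh : c * `|e2 1| + d * `|e1 1| <= b.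
  by apply: (fits_height c0 d0 Fe) => x y [_ /(_ isT)].
have := normr_ge0 (e1 0); have := normr_ge0 (e2 0) => q0 p0.
have := normr_ge0 (e1 1); have := normr_ge0 (e2 1) => q1 p1.
have [|||t t01 et] := @crossing_time R (fun t => k - `|e1 t|).
- by move=> t; apply: cvgB; [exact: cvg_cst|apply: cvg_norm; exact: ce].
- by nra.
- have := u 1 _; rewrite lexx ler01 => /(_ isT).
  rewrite -(real_normK (num_real (e1 1))) -(real_normK (num_real (e2 1))).
  have : `|e2 1| < s by nra.
  by move: `|e2 1| `|e1 1| q1 p1 {eh} => *; nra.
have e1k : `|e1 t| = k by lra.
have e2s := unit_norm_eq (u t t01) sk (ltW s0) e1k.
exact: (blocked_corner_arm c0 d0 s0 k0 sk ack bcs lt e1k e2s (F t t01)).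
Qed.

Lemma journey_opp (R : realType) (a b : R) i lo hi c d x0 y0 e1 e2 :
  journey a b i lo hi c d x0 y0 e1 e2 ->
  journey a b i lo hi c d x0 y0 (fun t => - e1 t) (fun t => - e2 t).
Proof.
case=> [[cx cy c1 c2] u F Fs Fe]; split.
- by split=> // t; apply: cvgN; [exact: c1|exact: c2].
- by move=> t /u; rewrite !sqrrN.
- by move=> t /F /fits_opp.
- exact: fits_opp.
- exact: fits_opp.
Qed.

(** After a half turn if necessary, the end of the long axis in the direction [(e1, e2)] is the
    upper one at the start. It goes from the left of the wall to [a <= x], so either it reaches the
    wall while [s <= e2], or [e2] comes down to [s] while it is still on the left. Both positions
    are blocked. *)
Lemma journey_quarter_slope (R : realType) (a b : R) hi c d x0 y0 e1 e2 (s k : R) :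
  0 < c -> 0 < d -> 0 < a -> 0 < b ->
  0 <= s -> 0 <= k -> s ^+ 2 + k ^+ 2 = 1 -> d < a * s -> d < b * k ->
  journey a b true true hi c d x0 y0 e1 e2 -> d <= a * s + b * k - c * s * k.
Proof.
move=> c0 d0 a0 b0 s0 k0 sk asd bkd.
wlog e20 : e1 e2 / 0 <= e2 0 => [W J|J].
  have [|/ltW] := leP 0 (e2 0); first by move=> e20; apply: W e20 J.
  by rewrite -oppr_ge0 => e20; apply: W e20 (journey_opp J).
rewrite leNgt; apply/negP => lt.
have [sw1 sw2] := journey_start_width c0 d0 J.
case: J => [[cx _ c1 c2] u F _ Fe].
have {}s0 : 0 < s by nra.
have {}k0 : 0 < k by nra.
have ack : a < c * k by rewrite -(ltr_pM2r s0); lra.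
have bcs : b < c * s by rewrite -(ltr_pM2r k0); lra.
have dq : 0 <= d * `|e2 0| by rewrite mulr_ge0 // ltW.
have [|||||t t01 H] :=
    @crossing_time_min R (fun t => a - x0 t - c / 2 * e1 t) (fun t => e2 t - s).
- move=> t; apply: cvgB; last by apply: cvgM; [exact: cvg_cst|exact: c1].
  by apply: cvgB; [exact: cvg_cst|exact: cx].
- by move=> t; apply: cvgB; [exact: c2|exact: cvg_cst].
- have : c * e1 0 <= c * `|e1 0| by rewrite ler_pM2l // ler_norm.
  lra.
- have := u 0 _; rewrite lexx ler01 => /(_ isT).
  rewrite -(real_normK (num_real (e1 0))).
  have := normr_ge0 (e1 0).
  move: `|e1 0| sw1 sw2 => K sw1 sw2 K0 KS.
  have : K < k by nra.
  by nra.
- left.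
  have hu : -c <= c / 2 * 2 <= c by lra.
  have hv : -d <= 0 * 2 <= d by lra.
  have Q x y : a <= x /\ (true && hi -> 0 < y < b) -> -1 * x + 0 * y <= - a.
    by case=> ax _; lra.
  by have := fits_halfplane c0 d0 Fe Q hu hv; lra.
have Ft := F t t01.
case: H => [[xt et]|[xt et]].
  apply: (blocked_door_quarter b0 c0 d0 _ _ _ Ft); [lra| |lra].
  by have : c * s <= c * e2 t; [rewrite ler_pM2l //; lra|lra].
move: Ft; rewrite (_ : e2 t = s); last by lra.
have e1k : `|e1 t| = k.
  have := u t t01; rewrite addrC => ut.
  have ks : k ^+ 2 + s ^+ 2 = 1 by rewrite addrC.
  apply: (unit_norm_eq ut ks (ltW k0)).
  by rewrite (_ : e2 t = s) ?gtr0_norm //; lra.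
apply: (blocked_corner_quarter b0 c0 d0 s0 k0 sk ack bcs lt e1k).
by lra.
Qed.

(** * From rigid motions to journeys *)

Section Plane.
Context {R : realType}.
Implicit Types (a b c d : R) (i : 'I_2) (j : 'I_4) (S : set (@plane R)).

Lemma sum_ord2 (V : nmodType) (F : 'I_2 -> V) : \sum_i F i = F 0 + F 1.
Proof. by rewrite big_ord_recl big_ord1; congr (_ + F _); apply: val_inj. Qed.

Lemma mulmx2 n (A : 'M[R]_2) (B : 'M[R]_(2, n)) i l :
  (A *m B) i l = A i 0 * B 0 l + A i 1 * B 1 l.
Proof. by rewrite mxE sum_ord2. Qed.

Lemma matrix2P n (A B : 'M[R]_(2, n)) :
  (forall l, A 0 l = B 0 l) -> (forall l, A 1 l = B 1 l) -> A = B.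
Proof.
move=> h0 h1; apply/matrixP => i l.
have [] : i = 0 \/ i = 1 by case: i => -[|[|//]] p; [left|right]; apply: val_inj.
  by move=> ->; exact: h0.
by move=> ->; exact: h1.
Qed.

Definition low j := (val j == 1%N) || (val j == 3%N).
Definition high j := (val j == 2%N) || (val j == 3%N).

Lemma start_partE a b i (p : plane) :
  start_part a b i p <->
  (xcoord p = a /\ 0 < ycoord p < b \/ 0 < xcoord p < a) /\
  (val i == 1%N -> 0 < ycoord p).
Proof.
case: i => -[|[|//]] hi; split=> h.
- by split.
- by case: h.
- by case: h => h h'; split.
- by case: h => h /(_ isT) h'; split.
Qed.

Lemma end_partE a b j (p : plane) :
  end_part a b j p <->
  [/\ xcoord p = a /\ 0 < ycoord p < b \/ a < xcoord p,
    low j -> 0 < ycoord p & high j -> ycoord p < b].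
Proof.
case: j => -[|[|[|[|//]]]] hj; split=> h.
- by split.
- by case: h.
- by case: h => h h'; split.
- by case: h => h /(_ isT) h' _; split.
- by case: h => h h'; split.
- by case: h => h _ /(_ isT) h'; split.
- by case: h => h /andP[h1 h2]; split.
- by case: h => h /(_ isT) h1 /(_ isT) h2; split=> //; apply/andP.
Qed.

Lemma corridorE a b i j (p : plane) : 0 < a ->
  corridor a b i j p <->
  region a b (val i == 1%N) (low j) (high j) (xcoord p) (ycoord p).
Proof.
move=> a0; rewrite /corridor; split.
  case=> [/start_partE[x fl]|/end_partE[x lo hi]].
    split; first by case: x => [[->]|/andP[]].
    - by case: x => [[]|/andP[_ xa] xE] //; move: xa; rewrite xE ltxx.
    - by move=> /fl.
    - by case: x => [[->]|/andP[_ xa] _ /(lt_trans xa)]; rewrite ltxx.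
    - by case: x => [[->]|/andP[_ xa] _ /(lt_trans xa)]; rewrite ltxx.
  split; first by case: x => [[->]|/(lt_trans a0)].
  - by case: x => [[]|xa xE] //; move: xa; rewrite xE ltxx.
  - by case: x => [[->]|xa _ /(lt_trans xa)]; rewrite ltxx.
  - by move=> /lo.
  - by move=> /hi.
move=> [x0 D I L H]; have [xa|xa|xa] := ltgtP (xcoord p) a.
- by left; apply/start_partE; split; [right; rewrite x0|move=> /I; apply].
- by right; apply/end_partE; split; [right|move=> /L; apply|move=> /H; apply].
- left; apply/start_partE; have yb := D xa; split; first by left.
  by move=> _; case/andP: yb.
Qed.

Definition box c d : set plane :=
  [set p | 0 < xcoord p < c /\ 0 < ycoord p < d].

Lemma orthogonal2 (A : 'M[R]_2) : A^T *m A = 1%:M ->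
  [/\ A 0 0 ^+ 2 + A 1 0 ^+ 2 = 1, A 0 1 ^+ 2 + A 1 1 ^+ 2 = 1 &
      A 0 0 * A 0 1 + A 1 0 * A 1 1 = 0].
Proof.
move=> E; have E' i l : A 0 i * A 0 l + A 1 i * A 1 l = (i == l)%:R.
  by have := congr1 (fun M : 'M[R]_2 => M i l) E; rewrite mulmx2 !mxE.
by rewrite !expr2 !E'.
Qed.

(** The second column of [A] is its determinant [D] times the first column turned by a right angle.
    As [D] is 1 or -1 and the rectangle is symmetric about its axis, [D * v] can stand for [v],
    which covers reflections too. *)
Lemma motion_fits (P : R -> R -> Prop) c d (A : 'M[R]_2) (q : 'cV[R]_2) :
  A^T *m A = 1%:M ->
  (forall p, box c d p -> P (xcoord (A *m p + q)) (ycoord (A *m p + q))) ->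
  fits P c d (A 0 0 * (c / 2) + A 0 1 * (d / 2) + q 0 0)
    (A 1 0 * (c / 2) + A 1 1 * (d / 2) + q 1 0) (A 0 0) (A 1 0).
Proof.
move=> /orthogonal2[h0 h1 h01] H u v hu hv.
set D := A 0 0 * A 1 1 - A 0 1 * A 1 0.
have D1 : D ^+ 2 = 1.
  have -> : D ^+ 2 = (A 0 0 ^+ 2 + A 1 0 ^+ 2) * (A 0 1 ^+ 2 + A 1 1 ^+ 2)
     - (A 0 0 * A 0 1 + A 1 0 * A 1 1) ^+ 2 by rewrite /D; ring.
  by rewrite h0 h1 h01; ring.
have DE : D = 1 \/ D = -1.
  by have /eqP := D1; rewrite -{1}(expr1n _ 2) eqf_sqr => /orP[]/eqP; [left|right].
have A01 : A 0 1 = - D * A 1 0.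
  have -> : - D * A 1 0 = A 0 1 * (A 0 0 ^+ 2 + A 1 0 ^+ 2)
     - A 0 0 * (A 0 0 * A 0 1 + A 1 0 * A 1 1) by rewrite /D; ring.
  by rewrite h0 h01; ring.
have A11 : A 1 1 = D * A 0 0.
  have -> : D * A 0 0 = A 1 1 * (A 0 0 ^+ 2 + A 1 0 ^+ 2)
     - A 1 0 * (A 0 0 * A 0 1 + A 1 0 * A 1 1) by rewrite /D; ring.
  by rewrite h0 h01; ring.
pose p : 'cV[R]_2 := \col_i (if i == 0 then c / 2 + u else d / 2 + D * v).
have p0 : p 0 0 = c / 2 + u by rewrite mxE.
have p1 : p 1 0 = d / 2 + D * v by rewrite mxE.
have : box c d p.
  rewrite /box /= /xcoord /ycoord p0 p1.
  by case: DE => ->; lra.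
move=> /H; rewrite /xcoord /ycoord ![(_ + q) _ _]mxE !mulmx2 p0 p1 A01 A11.
have -> : A 0 0 * (c / 2 + u) + - D * A 1 0 * (d / 2 + D * v) + q 0 0 =
  A 0 0 * (c / 2) + - D * A 1 0 * (d / 2) + q 0 0 + u * A 0 0
   - D ^+ 2 * v * A 1 0 by ring.
have -> : A 1 0 * (c / 2 + u) + D * A 0 0 * (d / 2 + D * v) + q 1 0 =
  A 1 0 * (c / 2) + D * A 0 0 * (d / 2) + q 1 0 + u * A 1 0
   + D ^+ 2 * v * A 0 0 by ring.
by rewrite D1 !mul1r.
Qed.

Lemma can_move_around_journey a b i j c d S : 0 < a ->
  open_rectangle c d S -> can_move_around a b i j S ->
  exists x0 y0 e1 e2,
    journey a b (val i == 1%N) (low j) (high j) c d x0 y0 e1 e2.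
Proof.
move=> a0 [c0 d0 [[G h] /= eG ->]] [Phi [cPhi ePhi starts ends stays]].
pose A t := (Phi t).1 *m G; pose q t := (Phi t).1 *m h + (Phi t).2.
have qE t p : box c d p -> motion (Phi t) (motion (G, h) p) = A t *m p + q t.
  by rewrite /motion /A /q /= mulmxDr mulmxA addrA.
have oA t : 0 <= t <= 1 -> (A t)^T *m A t = 1%:M.
  move=> /ePhi e; rewrite /A trmx_mul -mulmxA (mulmxA (Phi t).1^T) e mul1mx.
  exact: eG.
have ccoord1 k l : {within `[0, 1], continuous (fun t => (Phi t).1 k l)}.
  move=> t; apply: (@cvg_comp _ _ _ (fun t => (Phi t).1) (fun M : 'M[R]_2 => M k l)).
    apply: (@cvg_comp _ _ _ Phi fst); first exact: cPhi.
    exact: cvg_fst.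
  exact: coord_continuous.
have ccoord2 k : {within `[0, 1], continuous (fun t => (Phi t).2 k 0)}.
  move=> t; apply: (@cvg_comp _ _ _ (fun t => (Phi t).2) (fun M : 'cV[R]_2 => M k 0)).
    apply: (@cvg_comp _ _ _ Phi snd); first exact: cPhi.
    exact: cvg_snd.
  exact: coord_continuous.
have cA k l : {within `[0, 1], continuous (fun t => A t k l)}.
  rewrite (_ : (fun t => A t k l) =
     (fun t => (Phi t).1 k 0 * G 0 l + (Phi t).1 k 1 * G 1 l)); last first.
    by apply/funext => t; rewrite /A mulmx2.
  by move=> t; apply: cvgD; apply: cvgM; [exact: ccoord1|exact: cvg_cst
     |exact: ccoord1|exact: cvg_cst].
have cq k : {within `[0, 1], continuous (fun t => q t k 0)}.
  rewrite (_ : (fun t => q t k 0) =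
     (fun t => (Phi t).1 k 0 * h 0 0 + (Phi t).1 k 1 * h 1 0 + (Phi t).2 k 0)); last first.
    by apply/funext => t; rewrite /q mxE mulmx2.
  move=> t; apply: cvgD; last exact: ccoord2.
  by apply: cvgD; apply: cvgM; [exact: ccoord1|exact: cvg_cst
     |exact: ccoord1|exact: cvg_cst].
have ccenter k : {within `[0, 1], continuous
    (fun t => A t k 0 * (c / 2) + A t k 1 * (d / 2) + q t k 0)}.
  move=> t; apply: cvgD; last exact: cq.
  by apply: cvgD; apply: cvgM; [exact: cA|exact: cvg_cst|exact: cA|exact: cvg_cst].
have img t p : box c d p ->
   (motion (Phi t) @` (motion (G, h) @` box c d)) (A t *m p + q t).
  by move=> pB; exists (motion (G, h) p); [exists p|exact: qE].
have i0 : 0 <= (0 : R) <= 1 by rewrite lexx ler01.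
have i1 : 0 <= (1 : R) <= 1 by rewrite lexx ler01.
exists (fun t => A t 0 0 * (c / 2) + A t 0 1 * (d / 2) + q t 0 0).
exists (fun t => A t 1 0 * (c / 2) + A t 1 1 * (d / 2) + q t 1 0).
exists (fun t => A t 0 0), (fun t => A t 1 0); split.
- by split.
- by move=> t /oA /orthogonal2[].
- move=> t t01; apply: motion_fits; first exact: oA.
  by move=> p pB; apply/corridorE => //; apply: (stays t t01); exact: img.
- apply: motion_fits; first exact: oA.
  (* The starting part contains the door, whence only the weak bound [x <= a]. *)
  move=> p /(img 0)/starts/start_partE[[[-> _]|]]; first by rewrite a0 lexx.
  by move=> /andP[-> /ltW ->].
- apply: motion_fits; first exact: oA.
  move=> p /(img 1)/ends/end_partE[xa lo hi]; split.
    by case: xa => [[->]|/ltW].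
  by move=> /andP[/lo-> /hi->].
Qed.

End Plane.

(** * From paths of frames to rigid motions *)

Section Reach.
Context {R : realType}.
Implicit Types (a b c d : R) (i : 'I_2) (j : 'I_4) (S : set (@plane R)).

(** The moving frame has the origin [(X t, Y t)] and the columns [(k t, s t)] and [(l t, r t)], of
    either orientation. The motion is this frame composed with the inverse of the given placement
    [(G, h)]. *)
Lemma frame_can_move_around a b i j c d S (k s l r X Y : R -> R) : 0 < a ->
  open_rectangle c d S ->
  continuous k -> continuous s -> continuous l -> continuous r ->
  continuous X -> continuous Y ->
  (forall t, 0 <= t <= 1 -> [/\ k t ^+ 2 + s t ^+ 2 = 1,
    l t ^+ 2 + r t ^+ 2 = 1 & k t * l t + s t * r t = 0]) ->
  let px t u v := X t + k t * u + l t * v in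
  let py t u v := Y t + s t * u + r t * v in
  (forall u v, 0 < u < c -> 0 < v < d ->
    0 < px 0 u v < a /\ (val i == 1%N -> 0 < py 0 u v)) ->
  (forall u v, 0 < u < c -> 0 < v < d ->
    [/\ a < px 1 u v, low j -> 0 < py 1 u v & high j -> py 1 u v < b]) ->
  (forall t u v, 0 <= t <= 1 -> 0 < u < c -> 0 < v < d ->
    region a b (val i == 1%N) (low j) (high j) (px t u v) (py t u v)) ->
  can_move_around a b i j S.
Proof.
move=> a0 [c0 d0 [[G h] eG ->]] ck cs cl cr cX cY orth px py starts ends stays.
rewrite /euclidean /= in eG.
(* With these constants, [U] and [w] are combinations of fixed matrices with continuous
   coefficients, which makes their continuity immediate. *)
pose E m n : 'M[R]_2 := delta_mx m n *m G^T.
pose N t : 'M[R]_2 := k t *: delta_mx 0 0 + s t *: delta_mx 1 0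
  + l t *: delta_mx 0 1 + r t *: delta_mx 1 1.
pose U t : 'M[R]_2 := k t *: E 0 0 + s t *: E 1 0 + l t *: E 0 1 + r t *: E 1 1.
pose w t : 'cV[R]_2 := X t *: delta_mx 0 0 + Y t *: delta_mx 1 0 -
  (k t *: (E 0 0 *m h) + s t *: (E 1 0 *m h) + l t *: (E 0 1 *m h)
   + r t *: (E 1 1 *m h)).
have UE t : U t = N t *m G^T by rewrite /N !mulmxDl -!scalemxAl.
have wE t : w t = X t *: delta_mx 0 0 + Y t *: delta_mx 1 0 - U t *m h.
  by rewrite /U !mulmxDl -!scalemxAl.
have eG' : G *m G^T = 1%:M by apply: mulmx1C.
have movE t p : motion (U t, w t) (motion (G, h) p) =
    N t *m p + (X t *: delta_mx 0 0 + Y t *: delta_mx 1 0).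
  rewrite /motion /= wE mulmxDr UE -!mulmxA (mulmxA G^T) [G^T *m G]eG mul1mx.
  by rewrite addrACA subrr addr0.
have N00 t : N t 0 0 = k t by rewrite !mxE /=; lra.
have N10 t : N t 1 0 = s t by rewrite !mxE /=; lra.
have N01 t : N t 0 1 = l t by rewrite !mxE /=; lra.
have N11 t : N t 1 1 = r t by rewrite !mxE /=; lra.
have movx t p : xcoord (motion (U t, w t) (motion (G, h) p)) =
    px t (xcoord p) (ycoord p).
  rewrite movE /xcoord /ycoord [LHS]mxE mulmx2 N00 N01 /px !mxE /=; lra.
have movy t p : ycoord (motion (U t, w t) (motion (G, h) p)) =
    py t (xcoord p) (ycoord p).
  rewrite movE /xcoord /ycoord [LHS]mxE mulmx2 N10 N11 /py !mxE /=; lra.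
exists (fun t => (U t, w t)); split.
- apply: continuous_subspaceT => t.
  have cU : {for t, continuous U}.
    by rewrite /U; apply: cvgD; [apply: cvgD; [apply: cvgD|]|]; apply: cvgZr_tmp;
      [exact: ck|exact: cs|exact: cl|exact: cr].
  have cw : {for t, continuous w}.
    rewrite /w; apply: cvgB.
      by apply: cvgD; apply: cvgZr_tmp; [exact: cX|exact: cY].
    by apply: cvgD; [apply: cvgD; [apply: cvgD|]|]; apply: cvgZr_tmp;
      [exact: ck|exact: cs|exact: cl|exact: cr].
  exact: (cvg_pair cU cw).
- move=> t t01; rewrite /euclidean /= UE trmx_mul trmxK -mulmxA.
  have [h0 h1 h01] := orth t t01.
  suff NN : (N t)^T *m N t = 1%:M by rewrite (mulmxA (N t)^T) NN mul1mx.
  apply: matrix2P => n.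
    have [] : n = 0 \/ n = 1 by case: n => -[|[|//]] p; [left|right]; apply: val_inj.
      by move=> ->; rewrite mulmx2 !(mxE trmx_key) N00 N10 !mxE /=; lra.
    by move=> ->; rewrite mulmx2 !(mxE trmx_key) N00 N10 N01 N11 !mxE /=; lra.
  have [] : n = 0 \/ n = 1 by case: n => -[|[|//]] p; [left|right]; apply: val_inj.
    by move=> ->; rewrite mulmx2 !(mxE trmx_key) N00 N10 N01 N11 !mxE /=; lra.
  by move=> ->; rewrite mulmx2 !(mxE trmx_key) N01 N11 !mxE /=; lra.
- move=> _ [_ [p [hu hv] <-] <-]; apply/start_partE; rewrite movx movy.
  have [x0 y0] := starts _ _ hu hv.
  by split; [right|].
- move=> _ [_ [p [hu hv] <-] <-]; apply/end_partE; rewrite movx movy.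
  have [x0 y0 y1] := ends _ _ hu hv.
  by split; [right| |].
- move=> t t01 _ [_ [p [hu hv] <-] <-]; apply/corridorE => //; rewrite movx movy.
  exact: stays.
Qed.

End Reach.

(** * Poses that fit in a corridor *)

(* The pose (k, s, X, Y) is the rectangle with lower left corner (X, Y), whose
   side c goes down to the right along (k, -s). *)
Definition pose_ok {R : realFieldType} (a b c d : R) i lo hi (k s X Y : R) :=
  k ^+ 2 + s ^+ 2 = 1 /\ forall u v, 0 < u < c -> 0 < v < d ->
    region a b i lo hi (X + k * u + s * v) (Y - s * u + k * v).

Lemma pose_ok_imply (R : realFieldType) (a b c d : R) (i lo hi i' lo' hi' : bool)
    k s X Y : (i' -> i) -> (lo' -> lo) -> (hi' -> hi) ->
  pose_ok a b c d i lo hi k s X Y -> pose_ok a b c d i' lo' hi' k s X Y.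
Proof.
move=> ii ll hh [ks H]; split=> // u v hu hv.
by case: (H u v hu hv) => x0 D I L U; split=> // /[dup] => [/ii/I|/ll/L|/hh/U].
Qed.

Lemma cone_gt0 (R : realFieldType) (k s u v : R) :
  0 <= k -> 0 <= s -> k ^+ 2 + s ^+ 2 = 1 -> 0 < u -> 0 < v -> 0 < k * u + s * v.
Proof.
rewrite le_eqVlt => /predU1P[<- s0 ks u0 v0|k0 s0 _ u0 v0].
  by rewrite mul0r add0r mulr_gt0 //; nra.
by rewrite ltr_pwDl ?mulr_gt0 ?mulr_ge0 // ltW.
Qed.

(** The lower right corner stands on the floor. Beyond the wall the rectangle stays below [b],
    either because its upper long side passes below [(a, b)] or because the height [c * s + d * k]
    of its highest corner is at most [b]. *)
Lemma ladder_ok (R : realFieldType) (a b c d k s X : R) :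
  0 <= k -> 0 <= s -> k ^+ 2 + s ^+ 2 = 1 -> 0 < c -> 0 < d -> 0 <= X ->
  c * s * k + X * s + d <= a * s + b * k \/ c * s + d * k <= b ->
  pose_ok a b c d true true true k s X (c * s).
Proof.
move=> k0 s0 ks c0 d0 X0 H; split=> // u v hu hv.
have [u0 uc] := andP hu; have [v0 vd] := andP hv.
have cu : 0 < c - u by lra.
have su : 0 <= s * u by rewrite mulr_ge0; lra.
have kv : k * v <= k * d by rewrite ler_wpM2l; lra.
have xpos : 0 < X + k * u + s * v by have := cone_gt0 k0 s0 ks u0 v0; lra.
have ypos : 0 < c * s - s * u + k * v by have := cone_gt0 k0 s0 ks v0 cu; lra.
suff top : a <= X + k * u + s * v -> c * s - s * u + k * v < b.
  by split=> // [xE|_ /ltW //]; rewrite ypos top // xE.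
have dv : 0 < d - v by lra.
move=> ax; case: H => H; last by have := cone_gt0 k0 s0 ks dv u0; lra.
have E : k * (c * s - s * u + k * v) + s * (X + k * u + s * v) =
    c * s * k + X * s + v * (k ^+ 2 + s ^+ 2) by ring.
have lt : k * (c * s - s * u + k * v) < k * b.
  by rewrite ks in E; have := ler_wpM2l s0 ax; lra.
have {}k0 : 0 < k by move: lt; have [->|] := eqVneq k 0; [rewrite !mul0r ltxx|lra].
by rewrite -(ltr_pM2l k0).
Qed.

(** The line of the lower long side passes through [(a, 0)] for every [r], so the left part stays
    above the floor; that of the upper one does not pass above [(a, b)], because [d <= b * k]. *)
Lemma slide_ok (R : realFieldType) (a b c d k s r : R) :
  0 < k -> 0 <= s -> k ^+ 2 + s ^+ 2 = 1 -> 0 < c -> 0 < d ->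
  d <= b * k -> c * k <= a -> 0 <= r ->
  pose_ok a b c d true false true k s (a - c * k + r * k) (c * s - r * s).
Proof.
move=> k0 s0 ks c0 d0 db ca r0; split=> // u v hu hv.
set x := _ + s * v; set y := _ + k * v.
have E : k * y + s * x = a * s + v.
  by rewrite /x /y -[v in RHS]mulr1 -ks; ring.
have ku : 0 < k * u by rewrite mulr_gt0; lra.
have sv : 0 <= s * v by rewrite mulr_ge0; lra.
have rk : 0 <= r * k by rewrite mulr_ge0; lra.
have x0 : 0 < x by rewrite /x; lra.
clearbody x y.
have lo : x <= a -> 0 < y.
  by move=> xa; rewrite -(pmulr_rgt0 _ k0); have := ler_wpM2l s0 xa; lra.
have hi : a <= x -> y < b.
  by move=> xa; rewrite -(ltr_pM2l k0); have := ler_wpM2l s0 xa; lra.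
by split=> // [xa|_ /ltW|_ /ltW] //; rewrite lo ?hi // xa.
Qed.

(* While the pose tips, its upper long side passes through the corner (a, b) and
   its lower short side through (a, 0). *)
Lemma tip_ok (R : realFieldType) (a b c d k s : R) :
  0 < b -> 0 <= k -> 0 <= s -> k ^+ 2 + s ^+ 2 = 1 -> 0 < c -> 0 < d ->
  b * k <= d -> d <= a -> c * d <= a * b ->
  pose_ok a b c d false true true k s
    (a - c * k + b * k * s - d * s) (c * s + k * (b * k - d)).
Proof.
move=> b0 k0 s0 ks c0 d0 db da cd; split=> // u v hu hv.
set x := _ + s * v; set y := _ + k * v.
have E1 : k * y + s * x = a * s + b * k - d + v.
  have -> : a * s + b * k - d + v =
    a * s + b * k * (k ^+ 2 + s ^+ 2) - d * (k ^+ 2 + s ^+ 2) + v * (k ^+ 2 + s ^+ 2).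
    by rewrite ks; ring.
  by rewrite /x /y; ring.
have E2 : k * x - s * y = a * k - c + u.
  have -> : a * k - c + u =
    a * k - c * (k ^+ 2 + s ^+ 2) + u * (k ^+ 2 + s ^+ 2) by rewrite ks; ring.
  by rewrite /x /y; ring.
have [u0 uc] := andP hu; have [v0 vd] := andP hv.
have s1 : s <= 1 by nra.
(* Multiplied by [d], the abscissa of the leftmost corner is the sum of the two products below. *)
have base : 0 <= a - c * k + b * k * s - d * s.
  have h1 : 0 <= (d - b * k) * (a - s * d).
    by rewrite mulr_ge0 ?subr_ge0 //; nra.
  have h2 : 0 <= k * (a * b - c * d) by rewrite mulr_ge0 ?subr_ge0.
  by rewrite -(pmulr_rge0 _ d0); lra.
have x0 : 0 < x by rewrite /x; have := cone_gt0 k0 s0 ks u0 v0; lra.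
clearbody x y.
have lo : a <= x -> 0 < y.
  move=> xa; have lt : 0 < s * y by have := ler_wpM2l k0 xa; lra.
  have {}s0 : 0 < s by move: lt; have [->|] := eqVneq s 0; [rewrite mul0r ltxx|lra].
  by rewrite -(pmulr_rgt0 _ s0).
have hi : a <= x -> y < b.
  move=> xa; have lt : k * y < k * b by have := ler_wpM2l s0 xa; lra.
  have {}k0 : 0 < k by move: lt; have [->|] := eqVneq k 0; [rewrite !mul0r ltxx|lra].
  by rewrite -(ltr_pM2l k0).
by split=> // [xa|_ /ltW|_ /ltW] //; rewrite lo ?hi // xa.
Qed.

(** * Paths of poses and their concatenation *)

Section Reach.
Context {R : realType}.
Implicit Types (a b c d : R) (P : R -> R -> R -> R -> Prop).

(** Continuity is asked on the whole line but [P] only on the unit interval, so that paths can be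
    reparametrized and glued freely. *)
Definition reach P (p q : R * R * R * R) := exists k s X Y : R -> R, [/\
  [/\ continuous k, continuous s, continuous X & continuous Y],
  (k 0, s 0, X 0, Y 0) = p, (k 1, s 1, X 1, Y 1) = q &
  forall t, 0 <= t <= 1 -> P (k t) (s t) (X t) (Y t)].

Lemma reach_sym P p q : reach P p q -> reach P q p.
Proof.
case=> k [s [X [Y [[ck cs cX cY] p0 q1 H]]]].
have cr (f : R -> R) : continuous f -> continuous (fun t : R => f (1 - t)).
  move=> cf t; apply: (@cvg_comp R R R (fun t : R => 1 - t) f); last exact: cf.
  by apply: cvgB; [exact: cvg_cst|exact: cvg_id].
exists (fun t => k (1 - t)), (fun t => s (1 - t)), (fun t => X (1 - t)),
  (fun t => Y (1 - t)); split; rewrite ?subr0 ?subrr //.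
  by split; exact: cr.
by move=> t t01; apply: H; lra.
Qed.

Lemma reach_imply P P' p q :
  (forall k s X Y, P k s X Y -> P' k s X Y) -> reach P p q -> reach P' p q.
Proof.
move=> PP' [k [s [X [Y [cont p0 q1 H]]]]]; exists k, s, X, Y.
by split=> // t /H /PP'.
Qed.

(** Each path rests outside its half of the interval, and the common value [f 1 = g 0], counted
    twice, is subtracted; continuity then needs no case distinction. *)
Let glue (f g : R -> R) t := f (Num.min (2 * t) 1) + g (Num.max (2 * t - 1) 0) - f 1.

Let glue_continuous f g : continuous f -> continuous g -> continuous (glue f g).
Proof.
have cid : continuous (fun t : R => 2 * t).
  by move=> t; apply: cvgM; [exact: cvg_cst|exact: cvg_id].
have cmin : continuous (fun t : R => Num.min (2 * t) 1).
  by move=> t; apply: continuous_min; [exact: cid|exact: cvg_cst].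
have cmax : continuous (fun t : R => Num.max (2 * t - 1) 0).
  move=> t; apply: (@continuous_max R R (fun t => 2 * t - 1) (fun=> 0)).
    by apply: cvgB; [exact: cid|exact: cvg_cst].
  exact: cvg_cst.
move=> cf cg t; apply: cvgB; last exact: cvg_cst.
apply: cvgD.
  exact: (@cvg_comp R R R _ f _ _ _ (cmin t) (cf _)).
exact: (@cvg_comp R R R _ g _ _ _ (cmax t) (cg _)).
Qed.

Let glue_left f g t : f 1 = g 0 -> t <= 1 / 2 -> glue f g t = f (2 * t).
Proof.
move=> fg th; rewrite /glue; have /min_idPl -> : 2 * t <= 1 by lra.
have /max_idPr -> : 2 * t - 1 <= 0 by lra.
by rewrite -fg addrK.
Qed.

Let glue_right f g t : f 1 = g 0 -> 1 / 2 <= t -> glue f g t = g (2 * t - 1).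
Proof.
move=> fg th; rewrite /glue; have /min_idPr -> : 1 <= 2 * t by lra.
have /max_idPl -> : 0 <= 2 * t - 1 by lra.
by rewrite addrAC subrr add0r.
Qed.

Lemma reach_trans P p q r : reach P p q -> reach P q r -> reach P p r.
Proof.
case=> k [s [X [Y [[ck cs cX cY] <- <- H]]]].
case=> k' [s' [X' [Y' [[ck' cs' cX' cY'] [Ek Es EX EY] <- H']]]].
exists (glue k k'), (glue s s'), (glue X X'), (glue Y Y'); split.
- by split; exact: glue_continuous.
- by rewrite !glue_left ?mulr0 //; lra.
- by rewrite !glue_right // ?mulr1; [congr (_, _, _, _); congr (_ _); ring|lra..].
move=> t t01; have [th|/ltW th] := leP t (1 / 2).
  by rewrite !glue_left //; apply: H; lra.
by rewrite !glue_right //; apply: H'; lra.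
Qed.

Lemma reach_path P (k s X Y : R -> R) z0 z1 : z0 <= z1 ->
  continuous k -> continuous s -> continuous X -> continuous Y ->
  (forall z, z0 <= z <= z1 -> P (k z) (s z) (X z) (Y z)) ->
  reach P (k z0, s z0, X z0, Y z0) (k z1, s z1, X z1, Y z1).
Proof.
move=> z01 ck cs cX cY H; pose z t := z0 + t * (z1 - z0).
have cz (f : R -> R) : continuous f -> continuous (f \o z).
  move=> cf t; apply: (@cvg_comp R R R z f); last exact: cf.
  apply: cvgD; first exact: cvg_cst.
  by apply: cvgM; [exact: cvg_id|exact: cvg_cst].
have E0 : z 0 = z0 by rewrite /z; ring.
have E1 : z 1 = z1 by rewrite /z; ring.
exists (k \o z), (s \o z), (X \o z), (Y \o z); split=> /=; rewrite ?E0 ?E1 //.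
  by split; exact: cz.
by move=> t t01; apply: H; rewrite /z; nra.
Qed.

End Reach.

(** * The elementary motions *)

Section Sufficiency.
Context {R : realType}.
Implicit Types (a b c d : R) (i : 'I_2) (j : 'I_4) (S : set (@plane R)).

Lemma reach_can_move_around a b i j c d S k s X Y k' s' X' Y' : 0 < a ->
  open_rectangle c d S ->
  reach (pose_ok a b c d (val i == 1%N) (low j) (high j))
    (k, s, X, Y) (k', s', X', Y') ->
  (forall u v, 0 < u < c -> 0 < v < d -> 0 < X + k * u + s * v < a /\
    (val i == 1%N -> 0 < Y - s * u + k * v)) ->
  (forall u v, 0 < u < c -> 0 < v < d -> [/\ a < X' + k' * u + s' * v,
    low j -> 0 < Y' - s' * u + k' * v & high j -> Y' - s' * u + k' * v < b]) ->
  can_move_around a b i j S.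
Proof.
move=> a0 rS [fk [fs [fX [fY [[ck cs cX cY] [Ek Es EX EY] [Ek' Es' EX' EY'] H]]]]].
move=> starts ends.
apply: (frame_can_move_around a0 rS ck (s := fun t => - fs t) (l := fs) (r := fk)
  (X := fX) (Y := fY)) => //.
- by move=> t; apply: cvgN; exact: cs.
- by move=> t /H[ks _]; rewrite sqrrN [_ ^+ 2 + fk t ^+ 2]addrC ks; split=> //; ring.
- by move=> u v hu hv; rewrite Ek Es EX EY mulNr; exact: starts.
- by move=> u v hu hv; rewrite Ek' Es' EX' EY' mulNr; exact: ends.
- by move=> t u v /H[_ F] hu hv; rewrite mulNr; exact: F.
Qed.

(* The motion of the pose is reflected by y |-> b - y. *)
Lemma reach_can_move_around_mirror a b j c d S k s X Y k' s' X' Y' : 0 < a ->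
  open_rectangle c d S ->
  reach (pose_ok a b c d false (high j) (low j)) (k, s, X, Y) (k', s', X', Y') ->
  (forall u v, 0 < u < c -> 0 < v < d -> 0 < X + k * u + s * v < a) ->
  (forall u v, 0 < u < c -> 0 < v < d -> [/\ a < X' + k' * u + s' * v,
    high j -> 0 < Y' - s' * u + k' * v & low j -> Y' - s' * u + k' * v < b]) ->
  can_move_around a b 0 j S.
Proof.
move=> a0 rS [fk [fs [fX [fY [[ck cs cX cY] [Ek Es EX EY] [Ek' Es' EX' EY'] H]]]]].
move=> starts ends.
have cN (f : R -> R) : continuous f -> continuous (fun t => - f t).
  by move=> cf t; apply: cvgN; exact: cf.
have mir (Z z w u v : R) : b - Z + z * u + - w * v = b - (Z - z * u + w * v) by ring.
apply: (frame_can_move_around a0 rS ck cs cs (cN _ ck) cX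
  (Y := fun t => b - fY t)) => //.
- by move=> t; apply: cvgB; [exact: cvg_cst|exact: cY].
- by move=> t /H[ks _]; rewrite sqrrN [fs t ^+ 2 + _]addrC ks; split=> //; ring.
- by move=> u v hu hv; rewrite Ek Es EX; split=> //; exact: starts.
- move=> u v hu hv; rewrite Ek' Es' EX' EY' mir.
  by have [x lo hi] := ends u v hu hv; split=> // [/hi|/lo]; lra.
- move=> t u v /H[_ F] hu hv; rewrite mir; have [x D _ L U] := F u v hu hv.
  by split=> // [/D|/U U' /U'|/L L' /L']; lra.
Qed.

(** Rotations are parametrized by the cosine [z] of the slope, with this square root as the sine, so
    that all formulas stay algebraic. *)
Lemma continuous_cosine : continuous (fun z : R => Num.sqrt (1 - z ^+ 2)).
Proof.
move=> z; apply: (@cvg_comp R R R (fun z => 1 - z ^+ 2) Num.sqrt).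
  by apply: cvgB; [exact: cvg_cst|exact: exprn_continuous].
exact: sqrt_continuous.
Qed.

Lemma cosineK (z : R) : 0 <= z <= 1 -> z ^+ 2 + Num.sqrt (1 - z ^+ 2) ^+ 2 = 1.
Proof. by move=> z01; rewrite sqr_sqrtr; [ring|nra]. Qed.

Let cosine0 : Num.sqrt (1 - 0 ^+ 2) = 1 :> R.
Proof. by rewrite expr0n subr0 sqrtr1. Qed.

(** The lower long side slides with its ends on the two axes; for [X = 0] the condition of
    [ladder_ok] is the ladder inequality. *)
Lemma ladder_rotate a b c d z0 z1 : 0 < c -> 0 < d -> 0 <= z0 <= z1 -> z1 <= 1 ->
  (forall k s, z0 <= k <= z1 -> 0 <= s -> k ^+ 2 + s ^+ 2 = 1 ->
    d <= a * s + b * k - c * s * k) ->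
  let s0 := Num.sqrt (1 - z0 ^+ 2) in let s1 := Num.sqrt (1 - z1 ^+ 2) in
  reach (pose_ok a b c d true true true) (z0, s0, 0, c * s0) (z1, s1, 0, c * s1).
Proof.
move=> c0 d0 z01 z1le H /=.
apply: (@reach_path _ _ id (fun z => Num.sqrt (1 - z ^+ 2)) (fun=> 0)
  (fun z => c * Num.sqrt (1 - z ^+ 2)) z0 z1); first by case/andP: z01.
- by move=> z; exact: cvg_id.
- exact: continuous_cosine.
- by move=> z; exact: cvg_cst.
- by move=> z; apply: cvgM; [exact: cvg_cst|exact: continuous_cosine].
move=> z hz; have z1' : 0 <= z <= 1 by lra.
have ks := cosineK z1'.
apply: ladder_ok => //; rewrite ?sqrtr_ge0 //; first by lra.
by left; have := H _ _ hz (sqrtr_ge0 _) ks; lra.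
Qed.

Lemma ladder_shift a b c d k s x0 x1 : 0 <= k -> 0 <= s -> k ^+ 2 + s ^+ 2 = 1 ->
  0 < c -> 0 < d -> 0 <= x0 <= x1 ->
  c * s * k + x1 * s + d <= a * s + b * k \/ c * s + d * k <= b ->
  reach (pose_ok a b c d true true true) (k, s, x0, c * s) (k, s, x1, c * s).
Proof.
move=> k0 s0 ks c0 d0 x01 H.
apply: (@reach_path _ _ (fun=> k) (fun=> s) id (fun=> c * s) x0 x1);
  try by move=> z; first [exact: cvg_cst|exact: cvg_id].
  by case/andP: x01.
move=> z hz; apply: ladder_ok => //; first by lra.
case: H => H; [left|by right].
have : z * s <= x1 * s by rewrite ler_wpM2r //; lra.
lra.
Qed.

Lemma slide_out a b c d k s : 0 < k -> 0 <= s -> k ^+ 2 + s ^+ 2 = 1 ->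
  0 < c -> 0 < d -> d <= b * k -> c * k <= a ->
  reach (pose_ok a b c d true false true) (k, s, a - c * k, c * s) (k, s, a, 0).
Proof.
move=> k0 s0 ks c0 d0 db ca.
have := @reach_path _ (pose_ok a b c d true false true) (fun=> k) (fun=> s)
  (fun r => a - c * k + r * k) (fun r => c * s - r * s) 0 c (ltW c0).
rewrite !mul0r !addr0 !subr0 subrK subrr; apply.
- by move=> z; exact: cvg_cst.
- by move=> z; exact: cvg_cst.
- move=> z; apply: cvgD; first exact: cvg_cst.
  by apply: cvgM; [exact: cvg_id|exact: cvg_cst].
- move=> z; apply: cvgB; first exact: cvg_cst.
  by apply: cvgM; [exact: cvg_id|exact: cvg_cst].
by move=> z /andP[z0 _]; exact: slide_ok.
Qed.

(** From upright against the line [x = a], the rotation stops at the cosine [d / b]. There the chord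
    [d / k] fills the door exactly and the lower right corner is [(a, 0)], which is where
    [slide_out] begins. *)
Lemma tip_over a b c d : 0 < b -> 0 < c -> 0 < d -> d <= a -> d <= b ->
  c * d <= a * b ->
  let k := d / b in let s := Num.sqrt (1 - k ^+ 2) in
  reach (pose_ok a b c d false true true) (0, 1, a - d, c) (k, s, a - c * k, c * s).
Proof.
move=> b0 c0 d0 da db cd k s.
have bk : b * k = d by rewrite /k mulrC mulfVK // gt_eqF.
have k0 : 0 <= k by rewrite divr_ge0 // ltW.
have k1 : k <= 1 by rewrite ler_pdivrMr // mul1r.
pose S z : R := Num.sqrt (1 - z ^+ 2).
have cS : continuous S := continuous_cosine.
have S0 : S 0 = 1 := cosine0.
have := @reach_path _ (pose_ok a b c d false true true) id S
  (fun z => a - c * z + b * z * S z - d * S z)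
  (fun z => c * S z + z * (b * z - d)) 0 k k0.
rewrite -/(S k) bk subrr !mulr0 !mul0r !addr0 subr0 addrK S0 !mulr1.
apply.
- by move=> z; exact: cvg_id.
- exact: cS.
- move=> z; apply: cvgB; last by apply: cvgM; [exact: cvg_cst|exact: cS].
  apply: cvgD; last first.
    by apply: cvgM; [apply: cvgM; [exact: cvg_cst|exact: cvg_id]|exact: cS].
  by apply: cvgB; [exact: cvg_cst|apply: cvgM; [exact: cvg_cst|exact: cvg_id]].
- move=> z; apply: cvgD; first by apply: cvgM; [exact: cvg_cst|exact: cS].
  apply: cvgM; first exact: cvg_id.
  by apply: cvgB; [apply: cvgM; [exact: cvg_cst|exact: cvg_id]|exact: cvg_cst].
move=> z hz; apply: tip_ok => //; rewrite ?sqrtr_ge0 //; first by lra.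
  by apply: cosineK; lra.
by rewrite -bk ler_pM2l //; lra.
Qed.

End Sufficiency.

(** * The thresholds [height] and [m] *)

Section Height.
Context {R : realType}.
Implicit Types (a b c d k s : R).

Lemma height_sqr a b : 0 < a -> 0 < b ->
  height a b ^+ 2 * (a ^+ 2 + b ^+ 2) = (a * b) ^+ 2.
Proof.
move=> a0 b0; have n0 : 0 < a ^+ 2 + b ^+ 2 by rewrite addr_gt0 ?exprn_gt0.
by rewrite /height expr_div_n sqr_sqrtr ?(ltW n0) // mulfVK // gt_eqF.
Qed.

Lemma height_gt0 a b : 0 < a -> 0 < b -> 0 < height a b.
Proof.
move=> a0 b0; rewrite /height divr_gt0 ?mulr_gt0 // sqrtr_gt0.
by rewrite addr_gt0 ?exprn_gt0.
Qed.

Lemma le_height a b d : 0 < a -> 0 < b -> 0 < d ->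
  (d <= height a b) = (d ^+ 2 * (a ^+ 2 + b ^+ 2) <= (a * b) ^+ 2).
Proof.
move=> a0 b0 d0; have n0 : 0 < a ^+ 2 + b ^+ 2 by rewrite addr_gt0 ?exprn_gt0.
rewrite -height_sqr // ler_pM2r // ler_pXn2r ?nnegrE //; first exact: ltW.
exact/ltW/height_gt0.
Qed.

Lemma height_le a b d : 0 < a -> 0 < b -> 0 < d ->
  (height a b <= d) = ((a * b) ^+ 2 <= d ^+ 2 * (a ^+ 2 + b ^+ 2)).
Proof.
move=> a0 b0 d0; have n0 : 0 < a ^+ 2 + b ^+ 2 by rewrite addr_gt0 ?exprn_gt0.
rewrite -height_sqr // ler_pM2r // ler_pXn2r ?nnegrE //; last exact: ltW.
exact/ltW/height_gt0.
Qed.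

Lemma le_height_min a b d : 0 < a -> 0 < b -> 0 < d -> d <= height a b ->
  d <= a /\ d <= b.
Proof.
move=> a0 b0 d0; rewrite le_height // => H.
have a2 : 0 < a ^+ 2 by rewrite exprn_gt0.
have b2 : 0 < b ^+ 2 by rewrite exprn_gt0.
have d2 : 0 < d ^+ 2 by rewrite exprn_gt0.
split; rewrite -(ler_pXn2r (ltn0Sn 1)) ?nnegrE ?(ltW a0) ?(ltW b0) ?(ltW d0) //.
  rewrite -(ler_pM2r b2); have := mulr_gt0 d2 a2; rewrite exprMn in H.
  by lra.
rewrite -(ler_pM2r a2); have := mulr_gt0 d2 b2; rewrite exprMn in H.
by lra.
Qed.

(** The bound on [d] says that [(d / a) ^+ 2 + (d / b) ^+ 2 <= 1], so on the unit circle
    [k <= d / b] forces [d / a <= s]. All inequalities are reversed in [height_le_side]. *)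
Lemma le_height_side a b d k s : 0 < a -> 0 < b -> 0 < d -> d <= height a b ->
  0 <= s -> 0 <= k -> s ^+ 2 + k ^+ 2 = 1 -> b * k <= d -> d <= a * s.
Proof.
move=> a0 b0 d0; rewrite le_height // => H s0 k0 sk bk.
have b2 : 0 < b ^+ 2 by rewrite exprn_gt0.
have h : (b * k) ^+ 2 <= d ^+ 2 by rewrite ler_pXn2r ?nnegrE ?mulr_ge0 ?(ltW b0) ?(ltW d0).
rewrite -(ler_pXn2r (ltn0Sn 1)) ?nnegrE ?mulr_ge0 ?(ltW a0) ?(ltW d0) //.
rewrite -(ler_pM2r b2).
have : 0 <= a ^+ 2 * (d ^+ 2 - (b * k) ^+ 2) by rewrite mulr_ge0 ?exprn_ge0 ?subr_ge0 ?(ltW a0).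
have -> : (a * s) ^+ 2 * b ^+ 2 = a ^+ 2 * b ^+ 2 - a ^+ 2 * (b * k) ^+ 2.
  have E : s ^+ 2 = 1 - k ^+ 2 by lra.
  by rewrite exprMn E; ring.
by lra.
Qed.

Lemma height_le_side a b d k s : 0 < a -> 0 < b -> 0 < d -> height a b <= d ->
  0 <= s -> 0 <= k -> s ^+ 2 + k ^+ 2 = 1 -> d <= b * k -> a * s <= d.
Proof.
move=> a0 b0 d0; rewrite height_le // => H s0 k0 sk bk.
have b2 : 0 < b ^+ 2 by rewrite exprn_gt0.
have h : d ^+ 2 <= (b * k) ^+ 2 by rewrite ler_pXn2r ?nnegrE ?mulr_ge0 ?(ltW b0) ?(ltW d0).
rewrite -(ler_pXn2r (ltn0Sn 1)) ?nnegrE ?mulr_ge0 ?(ltW a0) ?(ltW d0) //.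
rewrite -(ler_pM2r b2).
have : 0 <= a ^+ 2 * ((b * k) ^+ 2 - d ^+ 2) by rewrite mulr_ge0 ?exprn_ge0 ?subr_ge0 ?(ltW a0).
have -> : (a * s) ^+ 2 * b ^+ 2 = a ^+ 2 * b ^+ 2 - a ^+ 2 * (b * k) ^+ 2.
  have E : s ^+ 2 = 1 - k ^+ 2 by lra.
  by rewrite exprMn E; ring.
by lra.
Qed.

(** A point [(s, k)] of the quarter circle replaces the angle, recovered as [acos k]; beyond this
    point no trigonometry remains. *)
Lemma le_mP a b c d : (d <= m a b c) <->
  (forall s k, 0 <= s -> 0 <= k -> s ^+ 2 + k ^+ 2 = 1 ->
    d <= a * s + b * k - c * s * k).
Proof.
have [[t0 t0I t0E] mle] := m_is_min a b c; split=> [dm s k s0 k0 sk|H].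
  have k1 : -1 <= k <= 1 by nra.
  have cosE : cos (acos k) = k by rewrite acosK // in_itv.
  have sinE : sin (acos k) = s.
    by rewrite sin_acos // -sk addrK sqrtr_sqr ger0_norm.
  have pi0 := pi_ge0 R.
  have acosI : 0 <= acos k <= pi / 2.
    rewrite acos_ge0 //= leNgt; apply/negP => gt.
    have : cos (acos k) < cos (pi / 2).
      by rewrite ltr_cos // in_itv /= ?acos_ge0 ?acos_lepi //; lra.
    by rewrite cosE cos_pihalf; lra.
  by have := mle _ acosI; rewrite /Defs.mfun cosE sinE; lra.
rewrite -t0E /Defs.mfun; apply: H.
- by apply: sin_ge0_pi; have := pi_ge0 R; lra.
- by apply: cos_ge0_pihalf; have := pi_ge0 R; lra.
- by rewrite addrC cos2Dsin2.
Qed.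

End Height.

(** * Necessary conditions and combined motions for rectangles *)

Section Corner.
Context {R : realType}.
Implicit Types (a b c d : R) (i : 'I_2) (j : 'I_4) (S : set (@plane R)).

(** The same path serves when walls are removed. *)
Lemma can_move_around_mono a b i j i' j' S : 0 < a ->
  (val i' == 1%N -> val i == 1%N) -> (low j' -> low j) -> (high j' -> high j) ->
  can_move_around a b i j S -> can_move_around a b i' j' S.
Proof.
move=> a0 ii ll hh [Phi [cPhi ePhi starts ends stays]]; exists Phi; split=> //.
- by move=> p /starts/start_partE[x fl]; apply/start_partE; split=> // /ii.
- move=> p /ends/end_partE[x lo hi]; apply/end_partE; split=> //.
    by move=> /ll.
  by move=> /hh.
- move=> t t01 p /(stays t t01)/(corridorE _ _ _ _ a0)[x0 D I L H].
  apply/(corridorE _ _ _ _ a0); split=> //.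
  + by move=> /ii.
  + by move=> /ll.
  + by move=> /hh.
Qed.

Lemma open_rectangle_swap c d S : open_rectangle c d S -> open_rectangle d c S.
Proof.
case=> c0 d0 [[U h] eU ->]; split=> //.
pose T : 'M[R]_2 := delta_mx 0 1 + delta_mx 1 0.
have T0 (p : 'cV[R]_2) : xcoord (T *m p) = ycoord p.
  by rewrite /xcoord mulmx2 !mxE /= /ycoord; ring.
have T1 (p : 'cV[R]_2) : ycoord (T *m p) = xcoord p.
  by rewrite /ycoord mulmx2 !mxE /= /xcoord; ring.
have TK (p : 'cV[R]_2) : T *m (T *m p) = p.
  apply: matrix2P => l; rewrite (ord1 l).
    by have := T0 (T *m p); rewrite T1.
  by have := T1 (T *m p); rewrite T0.
have TT : T^T *m T = 1%:M.
  apply: matrix2P => l.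
    by case: l => -[|[|//]] q; rewrite mulmx2 !mxE /=; ring.
  by case: l => -[|[|//]] q; rewrite mulmx2 !mxE /=; ring.
exists (U *m T, h).
  rewrite /euclidean /= in eU *.
  by rewrite trmx_mul -mulmxA (mulmxA U^T) eU mul1mx.
apply/seteqP; split=> _ [p [hx hy] <-].
  exists (T *m p); first by rewrite /= T0 T1.
  by rewrite /motion /= -mulmxA TK.
exists (T *m p); first by rewrite /= T0 T1.
by rewrite /motion /= -mulmxA.
Qed.

Lemma open_rectangle_ordered c d S : open_rectangle c d S ->
  exists c' d', [/\ 0 < d', d' <= c' & open_rectangle c' d' S].
Proof.
move=> rS; have [dc|/ltW cd] := leP d c.
  by exists c, d; case: (rS).
by exists d, c; split=> //; [case: (rS)|exact: open_rectangle_swap].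
Qed.

Lemma door_necessary a b i j c d S : 0 < a -> 0 < b -> 0 < d -> d <= c ->
  open_rectangle c d S -> can_move_around a b i j S ->
  [/\ d <= a, d <= b & c * d <= a * b].
Proof.
move=> a0 b0 d0 dc rS /(can_move_around_journey a0 rS)[x0 [y0 [e1 [e2 J]]]].
have [da db] := journey_door d0 dc b0 J.
by split=> //; exact: journey_area J.
Qed.

Lemma left_necessary a b j c d S k s : 0 < a -> 0 < b -> 0 < d -> d <= c ->
  open_rectangle c d S -> can_move_around a b 1 j S ->
  a < c -> b < c -> 0 <= s -> 0 <= k -> s ^+ 2 + k ^+ 2 = 1 ->
  a * s < d -> b * k < d -> d <= a * s + b * k - c * s * k.
Proof.
move=> a0 b0 d0 dc rS /(can_move_around_journey a0 rS)[x0 [y0 [e1 [e2 J]]]].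
by move=> ac bc s0 k0 sk asd bkd; exact: (journey_left_slope d0 dc a0 b0 ac bc _ _ _ _ _ J).
Qed.

Lemma arm_necessary a b c d S k s : 0 < a -> 0 < b -> 0 < c -> 0 < d ->
  open_rectangle c d S -> can_move_around a b 0 3 S ->
  0 <= s -> 0 <= k -> s ^+ 2 + k ^+ 2 = 1 ->
  d < a * s -> d < b * k -> d <= a * s + b * k - c * s * k.
Proof.
move=> a0 b0 c0 d0 rS /(can_move_around_journey a0 rS)[x0 [y0 [e1 [e2 J]]]].
by move=> s0 k0 sk asd bkd; exact: (journey_arm_slope c0 d0 a0 b0 _ _ _ _ _ J).
Qed.

Lemma quarter_necessary a b j c d S k s : low j ->
  0 < a -> 0 < b -> 0 < c -> 0 < d ->
  open_rectangle c d S -> can_move_around a b 1 j S ->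
  0 <= s -> 0 <= k -> s ^+ 2 + k ^+ 2 = 1 ->
  d < a * s -> d < b * k -> d <= a * s + b * k - c * s * k.
Proof.
move=> lj a0 b0 c0 d0 rS /(can_move_around_journey a0 rS)[x0 [y0 [e1 [e2 J]]]].
rewrite lj in J.
by move=> s0 k0 sk asd bkd; exact: (journey_quarter_slope c0 d0 a0 b0 _ _ _ _ _ J).
Qed.

Lemma reach_weaken a b c d (i lo hi i' lo' hi' : bool) p q :
  (i' -> i) -> (lo' -> lo) -> (hi' -> hi) ->
  reach (pose_ok a b c d i lo hi) p q -> reach (pose_ok a b c d i' lo' hi') p q.
Proof.
move=> ii ll hh; apply: reach_imply => k s X Y; exact: pose_ok_imply ii ll hh.
Qed.

Lemma pose_upright a c d (u v : R) : d <= a -> 0 < u < c -> 0 < v < d ->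
  0 < 0 + 0 * u + 1 * v < a /\ 0 < c - 1 * u + 0 * v.
Proof. by move=> da hu hv; lra. Qed.

Lemma pose_lying b c d x (u v : R) : d <= b -> 0 < u < c -> 0 < v < d ->
  x < x + 1 * u + 0 * v /\ 0 < 0 - 0 * u + 1 * v < b.
Proof. by move=> db hu hv; lra. Qed.

(** Upright against the wall [x = 0], the rectangle slides down as a ladder until it lies on the
    floor, and then moves to the right. The two extreme angles give [d <= a] and [d <= b]. *)
Lemma ladder_sufficient a b c d S : 0 < a -> 0 < b -> open_rectangle c d S ->
  (forall s k, 0 <= s -> 0 <= k -> s ^+ 2 + k ^+ 2 = 1 ->
    d <= a * s + b * k - c * s * k) ->
  can_move_around a b 1 3 S.
Proof.
move=> a0 b0 rS H; have [c0 d0 _] := rS.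
have E10 : 1 ^+ 2 + 0 ^+ 2 = 1 :> R by ring.
have E01 : 0 ^+ 2 + 1 ^+ 2 = 1 :> R by ring.
have da : d <= a by have := H _ _ ler01 (lexx 0) E10; lra.
have db : d <= b by have := H _ _ (lexx 0) ler01 E01; lra.
apply: (reach_can_move_around (k := 0) (s := 1) (X := 0) (Y := c)
  (k' := 1) (s' := 0) (X' := a) (Y' := 0) a0 rS).
- have R1 := @ladder_rotate R a b c d 0 1 c0 d0.
  rewrite /= expr0n expr1n subr0 subrr sqrtr1 sqrtr0 mulr0 mulr1 in R1.
  have R2 := @ladder_shift R a b c d 1 0 0 a ler01 (lexx 0) E10 c0 d0.
  rewrite mulr0 in R2; apply: (reach_trans (R1 _ _ _) (R2 _ _)); try lra.
  by move=> k s hk s0 ks; apply: H => //; [lra|rewrite addrC].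
- by move=> u v hu hv; have [] := pose_upright da hu hv.
- move=> u v hu hv; have [x y] := pose_lying a db hu hv.
  by split=> // _; case/andP: y.
Qed.

(** A translation is enough: lying if [c <= a], upright if [c <= b]. *)
Lemma straight_sufficient a b c d S : 0 < a -> 0 < b -> d <= c ->
  open_rectangle c d S -> c <= Num.max a b -> d <= Num.min a b ->
  can_move_around a b 1 3 S.
Proof.
move=> a0 b0 dc rS; rewrite le_max le_min => cab /andP[da db].
have [c0 d0 _] := rS.
have E10 : 1 ^+ 2 + 0 ^+ 2 = 1 :> R by ring.
have E01 : 0 ^+ 2 + 1 ^+ 2 = 1 :> R by ring.
case/orP: cab => h.
  apply: (reach_can_move_around (k := 1) (s := 0) (X := 0) (Y := 0)
    (k' := 1) (s' := 0) (X' := a) (Y' := 0) a0 rS).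
  - have R2 := @ladder_shift R a b c d 1 0 0 a ler01 (lexx 0) E10 c0 d0.
    rewrite mulr0 in R2; apply: R2; lra.
  - by move=> u v hu hv; have [] := pose_lying 0 db hu hv; lra.
  - move=> u v hu hv; have [x y] := pose_lying a db hu hv.
    by split=> // _; case/andP: y.
apply: (reach_can_move_around (k := 0) (s := 1) (X := 0) (Y := c)
  (k' := 0) (s' := 1) (X' := a) (Y' := c) a0 rS).
- have R2 := @ladder_shift R a b c d 0 1 0 a (lexx 0) ler01 E01 c0 d0.
  rewrite (mulr1 c) in R2; apply: R2; lra.
- by move=> u v hu hv; have [] := pose_upright da hu hv.
- by move=> u v hu hv; split; lra.
Qed.

Let angle_props b d : 0 < b -> 0 < d -> d <= b ->
  [/\ b * (d / b) = d, 0 < d / b <= 1,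
      (d / b) ^+ 2 + Num.sqrt (1 - (d / b) ^+ 2) ^+ 2 = 1 &
      0 <= Num.sqrt (1 - (d / b) ^+ 2)].
Proof.
move=> b0 d0 db; have bk : b * (d / b) = d by rewrite mulrC mulfVK // gt_eqF.
have k01 : 0 < d / b <= 1 by rewrite divr_gt0 // ler_pdivrMr // mul1r.
by split=> //; apply: cosineK; lra.
Qed.

(** The ladder slides from upright to the cosine [d / b], moves along the floor until its lower
    right corner is [(a, 0)], and leaves along its long side. *)
Lemma low_height_sufficient a b c d S : 0 < a -> 0 < b -> d <= c ->
  open_rectangle c d S -> d <= height a b -> c * d <= a * b ->
  can_move_around a b 1 2 S.
Proof.
move=> a0 b0 dc rS dh cd; have [c0 d0 _] := rS.
have [da db] := le_height_min a0 b0 d0 dh.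
have [bk /andP[k0 k1] ks s0] := angle_props b0 d0 db.
set k := d / b in bk k0 k1 ks s0; set s := Num.sqrt _ in ks s0.
have ck : c * k <= a by rewrite -(ler_pM2l b0) mulrCA bk; lra.
have as_ge : d <= a * s.
  by apply: (le_height_side a0 b0 d0 dh s0 (ltW k0)); rewrite ?bk // addrC.
apply: (reach_can_move_around (k := 0) (s := 1) (X := 0) (Y := c)
  (k' := k) (s' := s) (X' := a) (Y' := 0) a0 rS).
- have R1 := @ladder_rotate R a b c d 0 k c0 d0.
  rewrite /= expr0n subr0 sqrtr1 mulr1 -/s in R1.
  have R2 := @ladder_shift R a b c d k s 0 (a - c * k) (ltW k0) s0 ks c0 d0.
  have R3 : reach (pose_ok a b c d true false true) (k, s, a - c * k, c * s) (k, s, a, 0).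
    by apply: slide_out; rewrite ?bk.
  apply: reach_trans R3; apply: (@reach_weaken _ _ _ _ true true true) => //.
  apply: (reach_trans (R1 _ _ _) (R2 _ _)); try lra.
  (* Up to the cosine [d / b] one has [b * z <= d <= a * w], so the product in [ladder_sign] cannot
     be positive. *)
  move=> z w hz w0 zw; rewrite leNgt; apply/negP => lt.
  have z0 : 0 <= z by lra.
  have bz : b * z <= d by rewrite -bk ler_pM2l //; lra.
  have wz : w ^+ 2 + z ^+ 2 = 1 by rewrite addrC.
  have := le_height_side a0 b0 d0 dh w0 z0 wz bz.
  by have := ladder_sign w0 z0 d0 cd lt; nra.
- by move=> u v hu hv; have [] := pose_upright da hu hv.
- move=> u v hu hv; have [u0 _] := andP hu; have [v0 vd] := andP hv.
  have su : 0 <= s * u by rewrite mulr_ge0 // ltW.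
  have kv : k * v < b.
    by apply: le_lt_trans (_ : v < b); [rewrite ler_piMl // ltW|lra].
  have x0 := cone_gt0 (ltW k0) s0 ks u0 v0.
  by split=> // [|_]; lra.
Qed.

(** After tipping to the cosine [d / b], the rectangle is drawn back along the floor to the wall
    [x = 0], slides down from there as a ladder until it lies flat, and leaves through the door. *)
Lemma high_height_sufficient a b c d S : 0 < a -> 0 < b -> d <= c ->
  open_rectangle c d S -> height a b <= d -> d <= a -> d <= b -> c * d <= a * b ->
  can_move_around a b 0 3 S.
Proof.
move=> a0 b0 dc rS hd da db cd; have [c0 d0 _] := rS.
have [bk /andP[k0 k1] ks s0] := angle_props b0 d0 db.
have tip := tip_over b0 c0 d0 da db cd.
have E10 : 1 ^+ 2 + 0 ^+ 2 = 1 :> R by ring.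
set k := d / b in bk k0 k1 ks s0 tip; set s := Num.sqrt _ in ks s0 tip.
have ck : c * k <= a by rewrite -(ler_pM2l b0) mulrCA bk; lra.
apply: (reach_can_move_around (k := 0) (s := 1) (X := a - d) (Y := c)
  (k' := 1) (s' := 0) (X' := a) (Y' := 0) a0 rS).
- apply: reach_trans tip _; apply: (@reach_weaken _ _ _ _ true true true) => //.
  have R1 := @ladder_shift R a b c d k s 0 (a - c * k) (ltW k0) s0 ks c0 d0.
  have R2 := @ladder_rotate R a b c d k 1 c0 d0.
  have R3 := @ladder_shift R a b c d 1 0 0 a ler01 (lexx 0) E10 c0 d0.
  rewrite /= expr1n subrr sqrtr0 mulr0 -/s in R2; rewrite mulr0 in R3.
  apply: reach_trans (reach_sym (R1 _ _)) (reach_trans (R2 _ _ _) (R3 _ _)); try lra.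
  (* From the cosine [d / b] on, [a * w <= d <= b * z], which again contradicts [ladder_sign]. *)
  move=> z w hz w0 zw; rewrite leNgt; apply/negP => lt.
  have z0 : 0 <= z by lra.
  have bz : d <= b * z by rewrite -bk ler_pM2l //; lra.
  have wz : w ^+ 2 + z ^+ 2 = 1 by rewrite addrC.
  have := height_le_side a0 b0 d0 hd w0 z0 wz bz.
  by have := ladder_sign w0 z0 d0 cd lt; nra.
- by move=> u v hu hv; split=> //; lra.
- move=> u v hu hv; have [x y] := pose_lying a db hu hv.
  by split=> // _; case/andP: y.
Qed.

(** Tipping is followed by sliding. The first respects no floor on the left and the second none on
    the right, so only the ceiling is common to both. *)
Let slide_reach a b c d : 0 < a -> 0 < b -> 0 < c -> 0 < d -> d <= a -> d <= b ->
  c * d <= a * b ->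
  exists k s, [/\ 0 <= k <= 1, 0 <= s, k ^+ 2 + s ^+ 2 = 1 &
    reach (pose_ok a b c d false false true) (0, 1, a - d, c) (k, s, a, 0)].
Proof.
move=> a0 b0 c0 d0 da db cd.
have [bk /andP[k0 k1] ks s0] := angle_props b0 d0 db.
have tip := tip_over b0 c0 d0 da db cd.
set k := d / b in bk k0 k1 ks s0 tip; set s := Num.sqrt _ in ks s0 tip.
have ck : c * k <= a by rewrite -(ler_pM2l b0) mulrCA bk; lra.
exists k, s; split=> //; first by rewrite ltW.
have R2 : reach (pose_ok a b c d true false true) (k, s, a - c * k, c * s) (k, s, a, 0).
  by apply: slide_out; rewrite ?bk.
apply: reach_trans (_ : reach _ _ (k, s, a - c * k, c * s)) _.
  exact: reach_weaken tip.
exact: reach_weaken R2.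
Qed.

Lemma area_sufficient a b c d S j : j \in [:: 0; 1; 2] -> 0 < a -> 0 < b ->
  open_rectangle c d S -> d <= a -> d <= b -> c * d <= a * b ->
  can_move_around a b 0 j S.
Proof.
move=> hj a0 b0 rS da db cd; have [c0 d0 _] := rS.
have [k [s [k01 s0 ks rch]]] := slide_reach a0 b0 c0 d0 da db cd.
have starts u v : 0 < u < c -> 0 < v < d -> 0 < a - d + 0 * u + 1 * v < a.
  by move=> *; lra.
have ends u v : 0 < u < c -> 0 < v < d ->
    a < a + k * u + s * v /\ 0 - s * u + k * v < b.
  move=> hu hv; have [u0 _] := andP hu; have [v0 vd] := andP hv.
  have [k0 k1] := andP k01.
  have su : 0 <= s * u by rewrite mulr_ge0 // ltW.
  have kv : k * v <= v by rewrite ler_piMl // ltW.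
  by have := cone_gt0 k0 s0 ks u0 v0; lra.
have two : can_move_around a b 0 2 S.
  apply: (@reach_can_move_around R a b 0 2 c d S _ _ _ _ _ _ _ _ a0 rS rch) => u v hu hv; first by split=> //; exact: starts.
  by have [] := ends u v hu hv.
move: hj; rewrite !inE => /or3P[]/eqP->.
- exact: can_move_around_mono two.
- apply: (@reach_can_move_around_mirror R a b 1 c d S _ _ _ _ _ _ _ _ a0 rS rch) => u v hu hv; first exact: starts.
  by have [] := ends u v hu hv.
- by [].
Qed.

End Corner.

(** * The four characterizations *)

Section Characterization.
Context {R : realType}.
Variables (a b c d : R) (S : set (@plane R)).
Hypotheses (a0 : 0 < a) (b0 : 0 < b) (d0 : 0 < d) (dc : d <= c).
Hypothesis rS : open_rectangle c d S.

Let c0 : 0 < c.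
Proof. exact: lt_le_trans d0 dc. Qed.

Lemma movableE i j : movable a b i j S <-> can_move_around a b i j S.
Proof. by split=> [[]//|h]; split=> //; exists c, d. Qed.

Lemma le_m_area k s : d <= a -> d <= b -> c * d <= a * b ->
  0 <= s -> 0 <= k -> s ^+ 2 + k ^+ 2 = 1 ->
  (d < a * s -> d < b * k -> d <= a * s + b * k - c * s * k) ->
  (a * s < d -> b * k < d -> d <= a * s + b * k - c * s * k) ->
  d <= a * s + b * k - c * s * k.
Proof.
move=> da db cd s0 k0 sk below above; rewrite leNgt; apply/negP => lt.
have := ladder_sign s0 k0 d0 cd lt.
have [asd|das|->] := ltgtP (a * s) d; last by rewrite subrr mul0r ltxx.
  rewrite pmulr_rgt0 ?subr_gt0 // => bkd.
  by have := above asd bkd; rewrite leNgt lt.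
rewrite nmulr_rgt0 ?subr_lt0 // => dbk.
by have := below das dbk; rewrite leNgt lt.
Qed.

(** By [le_height_side], [d] cannot exceed both [a * s] and [b * k], so one of the two cases of
    [le_m_area] is void; [le_m_area_high] is the opposite situation. *)
Lemma le_m_area_low : d <= height a b -> c * d <= a * b ->
  (forall s k, 0 <= s -> 0 <= k -> s ^+ 2 + k ^+ 2 = 1 ->
    d < a * s -> d < b * k -> d <= a * s + b * k - c * s * k) ->
  d <= m a b c.
Proof.
move=> dh cd below; have [da db] := le_height_min a0 b0 d0 dh.
apply/le_mP => s k s0 k0 sk; apply: le_m_area => //; first exact: below.
move=> asd bkd; have := le_height_side a0 b0 d0 dh s0 k0 sk (ltW bkd).
by rewrite leNgt asd.
Qed.

Lemma le_m_area_high : height a b <= d -> d <= a -> d <= b -> c * d <= a * b ->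
  (forall s k, 0 <= s -> 0 <= k -> s ^+ 2 + k ^+ 2 = 1 ->
    a * s < d -> b * k < d -> d <= a * s + b * k - c * s * k) ->
  d <= m a b c.
Proof.
move=> hd da db cd above.
apply/le_mP => s k s0 k0 sk; apply: le_m_area => //; last exact: above.
move=> das dbk; have := height_le_side a0 b0 d0 hd s0 k0 sk (ltW dbk).
by rewrite leNgt das.
Qed.

Lemma ladder_movable i j : d <= m a b c -> movable a b i j S.
Proof.
move=> /le_mP H; apply/movableE.
by apply: can_move_around_mono (ladder_sufficient a0 b0 rS H).
Qed.

Lemma straight_movable i j : c <= Num.max a b -> d <= Num.min a b ->
  movable a b i j S.
Proof.
move=> cab dab; apply/movableE.
by apply: can_move_around_mono (straight_sufficient a0 b0 dc rS cab dab).
Qed.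

Lemma movable_area i j : movable a b i j S -> d <= Num.min a b /\ c * d <= a * b.
Proof.
move=> /movableE /(door_necessary a0 b0 d0 dc rS)[da db cd].
by rewrite le_min da db.
Qed.

Lemma movable0P j : j \in [:: 0; 1; 2] ->
  movable a b 0 j S <-> d <= Num.min a b /\ c * d <= a * b.
Proof.
move=> hj; split; first exact: movable_area.
rewrite le_min => -[/andP[da db] cd].
by apply/movableE; exact: (area_sufficient hj a0 b0 rS).
Qed.

Lemma movable03P : movable a b 0 3 S <->
  [/\ height a b <= d, d <= Num.min a b & c * d <= a * b] \/
  d <= Num.min (height a b) (m a b c).
Proof.
split=> [M|].
  have [dab cd] := movable_area M.
  have [hd|/ltW dh] := leP (height a b) d; [by left|right].
  rewrite le_min dh; apply: le_m_area_low => // s k s0 k0 sk.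
  by move/movableE: M => M; exact: arm_necessary rS M _ _ _.
rewrite !le_min => -[[hd /andP[da db] cd]|/andP[dh dm]].
  by apply/movableE; exact: (high_height_sufficient a0 b0 dc rS).
exact: ladder_movable.
Qed.

Lemma movable10P j : j \in [:: 0; 2] ->
  movable a b 1 j S <->
  [\/ d <= height a b /\ c * d <= a * b,
      [/\ height a b <= d, d <= Num.min a b & c <= Num.max a b] |
      height a b <= d /\ d <= m a b c].
Proof.
move=> hj; split=> [M|].
  have [dab cd] := movable_area M.
  have [dh|/ltW hd] := leP d (height a b); first by constructor 1.
  have [cab|] := leP c (Num.max a b); first by constructor 2.
  rewrite gt_max => /andP[ac bc]; constructor 3; split=> //.
  move: (dab); rewrite le_min => /andP[da db].
  apply: le_m_area_high => // s k s0 k0 sk.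
  by move/movableE: M => M; exact: left_necessary rS M ac bc _ _ _.
case=> [[dh cd]|[hd dab cab]|[hd dm]].
- apply/movableE; move: hj; rewrite !inE => /orP[]/eqP->;
    exact: can_move_around_mono (low_height_sufficient a0 b0 dc rS dh cd).
- exact: straight_movable.
- exact: ladder_movable.
Qed.

Lemma movable11P j : j \in [:: 1; 3] ->
  movable a b 1 j S <->
  (c <= Num.max a b /\ d <= Num.min a b) \/ d <= m a b c.
Proof.
move=> hj; split=> [M|[[cab dab]|dm]]; last 2 first.
- exact: straight_movable.
- exact: ladder_movable.
have [dab cd] := movable_area M.
have [cab|cab] := leP c (Num.max a b); [by left|right].
have lj : low j by move: hj; rewrite !inE => /orP[]/eqP->.
move: (dab); rewrite le_min => /andP[da db].
move: cab; rewrite gt_max => /andP[ac bc]; move/movableE: M => M.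
apply/le_mP => s k s0 k0 sk; apply: le_m_area => //.
  exact: (quarter_necessary lj a0 b0 c0 d0 rS M).
exact: (left_necessary a0 b0 d0 dc rS M).
Qed.

End Characterization.

(** * Equalities between the sets of rectangles *)

Lemma rectangle_sets_eq (R : realType) (A B : set (set (@plane R))) :
  (forall S, A S \/ B S -> exists c d, open_rectangle c d S) ->
  (forall c d S, 0 < d -> d <= c -> open_rectangle c d S -> A S <-> B S) ->
  A = B.
Proof.
move=> AB H; apply/seteqP.
have rect S : A S \/ B S -> A S <-> B S.
  (* The characterizations suppose [d <= c], which exchanging the sides provides for every
     rectangle. *)
  move=> /AB[c [d /open_rectangle_ordered[c' [d' [d0 dc rS]]]]].
  exact: H d0 dc rS.
by split=> S h; [apply/(rect S (or_introl h))|apply/(rect S (or_intror h))].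
Qed.


Theorem theorem1 (R : realType) (a b : R) (ha : 0 < a) (hb : 0 < b) :
  [/\ movable a b 0 0 = movable a b 0 1 /\ movable a b 0 1 = movable a b 0 2,
      movable a b 1 0 = movable a b 1 2,
      movable a b 1 1 = movable a b 1 3,
      movable a b 0 0 = movable a b 1 0 `|` movable a b 0 3 &
      movable a b 1 3 = movable a b 1 0 `&` movable a b 0 3] /\
  forall (c d : R) (S : set plane), 0 < d -> d <= c -> open_rectangle c d S ->
  [/\ forall j : 'I_4, j \in [:: 0; 1; 2] ->
        (movable a b 0 j S <->
          d <= Num.min a b /\ c * d <= a * b),
      movable a b 0 3 S <->
        [/\ height a b <= d, d <= Num.min a b & c * d <= a * b] \/
        d <= Num.min (height a b) (m a b c),
      forall j : 'I_4, j \in [:: 0; 2] ->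
        (movable a b 1 j S <->
          [\/ d <= height a b /\ c * d <= a * b,
              [/\ height a b <= d, d <= Num.min a b & c <= Num.max a b] |
              height a b <= d /\ d <= m a b c]) &
      forall j : 'I_4, j \in [:: 1; 3] ->
        (movable a b 1 j S <->
          (c <= Num.max a b /\ d <= Num.min a b) \/ d <= m a b c)].
Proof.
split; last first.
  move=> c d S d0 dc rS; split.
  - by move=> j hj; exact: movable0P rS _ hj.
  - exact: movable03P.
  - by move=> j hj; exact: movable10P rS _ hj.
  - by move=> j hj; exact: movable11P rS _ hj.
have movable_rect i j S : movable a b i j S -> exists c d, open_rectangle c d S.
  by case.
have P0 c d S (d0 : 0 < d) (dc : d <= c) (rS : open_rectangle c d S) :=
  movable0P ha hb d0 dc rS.
have P1 c d S (d0 : 0 < d) (dc : d <= c) (rS : open_rectangle c d S) :=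
  movable10P ha hb d0 dc rS.
have P3 c d S (d0 : 0 < d) (dc : d <= c) (rS : open_rectangle c d S) :=
  movable11P ha hb d0 dc rS.
have P03 c d S (d0 : 0 < d) (dc : d <= c) (rS : open_rectangle c d S) :=
  movable03P ha hb d0 dc rS.
split; [split| | | |]; apply: rectangle_sets_eq => [S|c d S d0 dc rS].
- by case; exact: movable_rect.
- exact: iff_trans (P0 _ _ _ d0 dc rS 0 isT) (iff_sym (P0 _ _ _ d0 dc rS 1 isT)).
- by case; exact: movable_rect.
- exact: iff_trans (P0 _ _ _ d0 dc rS 1 isT) (iff_sym (P0 _ _ _ d0 dc rS 2 isT)).
- by case; exact: movable_rect.
- exact: iff_trans (P1 _ _ _ d0 dc rS 0 isT) (iff_sym (P1 _ _ _ d0 dc rS 2 isT)).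
- by case; exact: movable_rect.
- exact: iff_trans (P3 _ _ _ d0 dc rS 1 isT) (iff_sym (P3 _ _ _ d0 dc rS 3 isT)).
- by case=> [|[]]; exact: movable_rect.
- split=> [M|[M|M]]; last 2 first.
  + by apply/(P0 c d S) => //; exact: movable_area M.
  + by apply/(P0 c d S) => //; exact: movable_area M.
  have [dab cd] := movable_area ha hb d0 dc rS M.
  (* Under the area bound, one set of the union contains the rectangles with [d <= height a b], the
     other those with [height a b <= d]. *)
  have [dh|/ltW hd] := leP d (height a b).
    by left; apply/(P1 c d S) => //; constructor 1.
  by right; apply/(P03 c d S) => //; left.
- by case=> [|[+ _]]; exact: movable_rect.
- split=> [[rect M]|[M10 M03]].
    by split; split=> //; exact: can_move_around_mono M.
  have [dab cd] := movable_area ha hb d0 dc rS M03.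
  apply/(P3 c d S) => //.
  have dhm : d <= height a b -> d <= m a b c.
    move=> dh; case/(P03 c d S d0 dc rS): M03 => [[hd _ _]|]; last first.
      by rewrite le_min => /andP[].
    (* Here [d] equals the height, so [height_le_side] also rules out [d] below both [a * s] and
       [b * k]. *)
    apply: (le_m_area_low ha hb d0 dh cd) => s k s0 k0 sk das dbk.
    have := height_le_side ha hb d0 hd s0 k0 sk (ltW dbk).
    by rewrite leNgt das.
  case/(P1 c d S): M10 => // [[dh _]|[_ _ cab]|[_ dm]]; last by right.
    by right; exact: dhm.
  by left.
Qed.
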